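(* Let $Q\in\mathbb{R}^{m\times m}$ be symmetric and $D\in\mathbb{R}^{k\times m}$. Suppose that $Q$ is copositive on $D_\infty$ and that $\mathrm{dom}(Q,D)$ is convex. Then the value function $\mathrm{qp}_{\rm opt}(q,b)$ is dc on $\mathrm{dom}(Q,D)$, provided that $\mathrm{qp}_{\rm opt}$ is a quadratic function on each polyhedron belonging to the family $\mathcal{F}$ (defined in the context). In particular, $\mathrm{qp}_{\rm opt}(q,b)$ is dc on $\mathrm{dom}(Q,D)$ if $Q$ is positive semidefinite.
   Context: A function on a convex set is dc (difference-of-convex) if it is the difference of two real-valued convex functions on that set. A ''quadratic function'' is a polynomial of degree at most two, not necessarily convex. For $(q,b)\in\mathbb{R}^m\times\mathbb{R}^k$, $\mathrm{qp}_{\rm opt}(q,b)$ is the optimal (infimum) value of the quadratic program: minimize $q^Tz+\tfrac12 z^TQz$ over $z\in\mathbb{R}^m$ subject to $Dz\ge b$. $\mathrm{dom}(Q,D)=\{(q,b)\in\mathbb{R}^{m+k} : -\infty<\mathrm{qp}_{\rm opt}(q,b)<\infty\}$. $D_\infty=\{v\in\mathbb{R}^m : Dv\ge 0\}$; $Q$ is copositive on $D_\infty$ if $v^TQv\ge 0$ for all $v\in D_\infty$. The family $\mathcal{F}$. For a subset $\mathcal{I}\subseteq\{1,\dots,k\}$ with complement $\mathcal{J}$, let $D_{\mathcal{I}\bullet}$ denote the rows of $D$ indexed by $\mathcal{I}$. Let $\mathrm{QD}(\mathcal{I})$ be the polyhedral cone of all $(q,b)\in\mathbb{R}^{m+k}$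 for which there exist $z\in\mathbb{R}^m$ and $\eta_{\mathcal I}\in\mathbb{R}^{|\mathcal I|}$ with $q+Qz-(D_{\mathcal{I}\bullet})^T\eta_{\mathcal{I}}=0$, $D_{\mathcal{I}\bullet}z=b_{\mathcal{I}}$, $\eta_{\mathcal{I}}\ge 0$, $D_{\mathcal{J}\bullet}z\ge b_{\mathcal{J}}$. Let $\{(v^{\mathcal{I},\ell},\xi^{\mathcal{I},\ell})\}_{\ell=1}^{L_{\mathcal{I}}}$ be a finite set of generators (i.e. whose conical hull is the cone) of the polyhedral cone of all $(v,\xi)\in\mathbb{R}^{m+k}$ with $Qv-(D_{\mathcal{I}\bullet})^T\xi_{\mathcal{I}}=0$, $D_{\mathcal{I}\bullet}v=0$, $\xi_{\mathcal{I}}\ge 0$, $D_{\mathcal{J}\bullet}v\ge 0$, $\xi_{\mathcal{J}}=0$. Let $\mathcal{E}(\mathcal{I},\ell)$ be the finite set of extreme points of the polyhedron $\{\mu\in\mathbb{R}^k_+ : D^T\mu=Qv^{\mathcal{I},\ell}\}$. Let $\mathcal{V}=\prod_{(\mathcal{I},\ell)}\mathcal{E}(\mathcal{I},\ell)$, the product being over all $\mathcal{I}\subseteq\{1,\dots,k\}$ and $\ell=1,\dots,L_{\mathcal{I}}$. For $\boldsymbol{\mu}=(\mu^{\mathcal{I},\ell})_{(\mathcal{I},\ell)}\in\mathcal{V}$ let $$\mathrm{dom}^{\boldsymbol{\mu}}(Q,D)=\{(q,b)\in\mathbb{R}^m\times[D\mathbb{R}^m-\mathbb{R}^k_+] : q^Tv^{\mathcal{I},\ell}+b^T\mu^{\mathcal{I},\ell}\ge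 0 \text{ for all } (\mathcal{I},\ell)\}.$$ Then $$\mathcal{F}=\{\mathrm{dom}^{\boldsymbol{\mu}}(Q,D)\cap \mathrm{QD}(\mathcal{I}') : \boldsymbol{\mu}\in\mathcal{V},\ \mathcal{I}'\subseteq\{1,\dots,k\}\}.$$ *)

(* Defs.v *)
From HB Require Import structures.
From mathcomp Require Import all_boot all_order all_algebra.
From mathcomp Require Import boolp classical_sets reals constructive_ereal ereal convex.

Set Implicit Arguments.
Unset Strict Implicit.
Unset Printing Implicit Defensive.

Import Order.TTheory GRing.Theory Num.Theory.

Local Open Scope classical_set_scope.
Local Open Scope ring_scope.

Section VectorsAndConvexity.
Variable R : realType.

Definition dotp n (x y : 'cV[R]_n) : R := (x^T *m y) 0 0.

Definition quadform n (A : 'M[R]_n) (x : 'cV[R]_n) : R := (x^T *m A *m x) 0 0.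

Definition lev n (x y : 'cV[R]_n) : Prop := forall i, x i 0 <= y i 0.

(* Rows of [A] indexed by [I], in increasing order; for a column vector these
   are its coordinates in [I]. *)
Definition rows k n (I : {set 'I_k}) (A : 'M[R]_(k, n)) : 'M[R]_(#|I|, n) :=
  rowsub (fun i : 'I_#|I| => enum_val i) A.

Definition copositive_on n (A : 'M[R]_n) (K : set 'cV[R]_n) : Prop :=
  forall v, K v -> 0 <= quadform A v.

Definition psd n (A : 'M[R]_n) : Prop := forall v, 0 <= quadform A v.

Definition extreme_points (V : lmodType R) (P : set V) : set V :=
  [set x | P x /\ forall y z (t : R), P y -> P z -> 0 < t < 1 ->
             x = t *: y + (1 - t) *: z -> y = x /\ z = x].

Definition conical_hull (V : lmodType R) (L : nat) (g : 'I_L -> V) : set V :=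
  [set x | exists c : 'I_L -> R,
     (forall l, 0 <= c l) /\ x = \sum_(l < L) c l *: g l].

(* The value function may be infinite off its domain, so it is stated to
   coincide on [S] with a difference of real-valued functions. *)
Definition dc_on (V : lmodType R) (S : set V) (f : V -> \bar R) : Prop :=
  convex_set S /\
  exists g h : V -> R,
    [/\ convex_function S g, convex_function S h
      & forall x, S x -> f x = (g x - h x)%:E].

(* A polynomial of degree at most two in the m + k coordinates of (q, b); the
   matrix of its quadratic part is arbitrary. *)
Definition quadratic_on m k (P : set ('cV[R]_m * 'cV[R]_k))
    (f : 'cV[R]_m * 'cV[R]_k -> \bar R) : Prop :=
  exists (A : 'M[R]_(m + k)) (c : 'cV[R]_(m + k)) (d : R),
    forall p, P p ->
      f p = (quadform A (col_mx p.1 p.2) + dotp c (col_mx p.1 p.2) + d)%:E.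

End VectorsAndConvexity.

Section QuadraticProgram.
Variables (R : realType) (m k : nat) (Q : 'M[R]_m) (D : 'M[R]_(k, m)).

Definition qp_obj (q z : 'cV[R]_m) : R := dotp q z + 2^-1 * quadform Q z.

(* Equal to +oo when the program is infeasible. *)
Definition qp_opt (p : 'cV[R]_m * 'cV[R]_k) : \bar R :=
  ereal_inf [set (qp_obj p.1 z)%:E | z in [set z | lev p.2 (D *m z)]].

Definition qp_dom : set ('cV[R]_m * 'cV[R]_k) :=
  [set p | (-oo < qp_opt p)%E /\ (qp_opt p < +oo)%E].

Definition D_inf : set 'cV[R]_m := [set v | lev 0 (D *m v)].

Definition QD (I : {set 'I_k}) : set ('cV[R]_m * 'cV[R]_k) :=
  [set p | exists (z : 'cV[R]_m) (eta : 'cV[R]_#|I|),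
     [/\ p.1 + Q *m z - (rows I D)^T *m eta = 0,
         rows I D *m z = rows I p.2,
         lev 0 eta
       & lev (rows (~: I) p.2) (rows (~: I) D *m z)]].

Definition critical_cone (I : {set 'I_k}) : set ('cV[R]_m * 'cV[R]_k) :=
  [set p | [/\ Q *m p.1 - (rows I D)^T *m rows I p.2 = 0,
               rows I D *m p.1 = 0,
               lev 0 (rows I p.2),
               lev 0 (rows (~: I) D *m p.1)
             & rows (~: I) p.2 = 0]].

(* D R^m - R^k_+ *)
Definition feasible_rhs : set 'cV[R]_k :=
  [set b | exists (z : 'cV[R]_m) (s : 'cV[R]_k), lev 0 s /\ b = D *m z - s].

(* For each index set I, the family [gen I] lists the L_I generators
   (v^{I,l}, xi^{I,l}). *)
Variables (L : {set 'I_k} -> nat)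
  (gen : forall I : {set 'I_k}, 'I_(L I) -> 'cV[R]_m * 'cV[R]_k).

Definition is_generators : Prop :=
  forall I, conical_hull (@gen I) = critical_cone I.

Definition ext_mult (I : {set 'I_k}) (l : 'I_(L I)) : set 'cV[R]_k :=
  extreme_points [set mu | lev 0 mu /\ D^T *m mu = Q *m (gen l).1].

(* The product of the sets [ext_mult] over all pairs (I, l). *)
Definition mult_selections :
    set (forall I : {set 'I_k}, 'I_(L I) -> 'cV[R]_k) :=
  [set mu | forall I (l : 'I_(L I)), ext_mult l (mu I l)].

Definition dom_mu (mu : forall I : {set 'I_k}, 'I_(L I) -> 'cV[R]_k) :
    set ('cV[R]_m * 'cV[R]_k) :=
  [set p | feasible_rhs p.2 /\
     forall I (l : 'I_(L I)), 0 <= dotp p.1 (gen l).1 + dotp p.2 (mu I l)].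

Definition family_F : set (set ('cV[R]_m * 'cV[R]_k)) :=
  [set P | exists mu (I : {set 'I_k}),
     mult_selections mu /\ P = dom_mu mu `&` QD I].

End QuadraticProgram.

(* Main.v *)
(* By Frank and Wolfe's theorem every (q, b) in the domain admits a KKT point,
   so the domain is covered by the cones QD(I), and linear programming duality
   refines this to a cover by the members of F. These are finitely many
   polyhedral cones on each of which the value function is quadratic.

   Such a piecewise quadratic function f on a convex set becomes convex after
   adding a convex function h that bends across every hyperplane a.x = 0
   bounding a piece, the kink being proportional to |a.d| (1 + |x|) in the
   direction d, plus a large multiple of |x|^2. Indeed, if two pieces meet at z,
   their gradients at z agree along the directions d with a.d = 0 for all a
   active at z, hence differ along d by at most C (1 + |z|) sum |a.d| over those
   a. Convexity of f + h on a segment follows by induction on the number of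
   hyperplanes that it crosses.

   If Q is positive semidefinite, KKT points are global minimizers and solve a
   linear system in (q, b), so that the value is quadratic on each QD(I). *)

Require Import Defs.
From mathcomp Require Import all_boot all_order all_algebra.
From mathcomp Require Import boolp classical_sets reals constructive_ereal ereal convex.
From mathcomp Require Import lra ring.

Set Implicit Arguments.
Unset Strict Implicit.
Unset Printing Implicit Defensive.

Import Order.TTheory GRing.Theory Num.Theory.
Local Open Scope classical_set_scope.
Local Open Scope ring_scope.

(** * Dot products and the componentwise order *)

Section DotProduct.
Variable R : realType.
Implicit Types (n k m : nat).

Lemma dotpE n (x y : 'cV[R]_n) : dotp x y = \sum_i x i 0 * y i 0.
Proof. by rewrite /dotp mxE; apply: eq_bigr => i _; rewrite mxE. Qed.

Lemma dotpC n (x y : 'cV[R]_n) : dotp x y = dotp y x.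
Proof. by rewrite !dotpE; apply: eq_bigr => i _; rewrite mulrC. Qed.

Lemma dotpDr n (x y z : 'cV[R]_n) : dotp x (y + z) = dotp x y + dotp x z.
Proof. by rewrite /dotp mulmxDr mxE. Qed.

Lemma dotpDl n (x y z : 'cV[R]_n) : dotp (x + y) z = dotp x z + dotp y z.
Proof. by rewrite !(dotpC _ z) dotpDr. Qed.

Lemma dotpNr n (x y : 'cV[R]_n) : dotp x (- y) = - dotp x y.
Proof. by rewrite /dotp mulmxN mxE. Qed.

Lemma dotpNl n (x y : 'cV[R]_n) : dotp (- x) y = - dotp x y.
Proof. by rewrite !(dotpC _ y) dotpNr. Qed.

Lemma dotpZr n (x y : 'cV[R]_n) t : dotp x (t *: y) = t * dotp x y.
Proof. by rewrite /dotp -scalemxAr mxE. Qed.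

Lemma dotpZl n (x y : 'cV[R]_n) t : dotp (t *: x) y = t * dotp x y.
Proof. by rewrite !(dotpC _ y) dotpZr. Qed.

Lemma dotp0r n (x : 'cV[R]_n) : dotp x 0 = 0.
Proof. by rewrite /dotp mulmx0 mxE. Qed.

Definition dotp_linE := (dotpDl, dotpDr, dotpNl, dotpNr, dotpZl, dotpZr).

Lemma dotp_mulmx k m (A : 'M[R]_(k, m)) x y :
  dotp x (A *m y) = dotp (A^T *m x) y.
Proof. by rewrite /dotp trmx_mul trmxK mulmxA. Qed.

Lemma dotp_col_mx m k (x x' : 'cV[R]_m) (y y' : 'cV[R]_k) :
  dotp (col_mx x y) (col_mx x' y') = dotp x x' + dotp y y'.
Proof. by rewrite /dotp tr_col_mx mul_row_col mxE. Qed.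

Lemma mulmx_row k m (A : 'M[R]_(k, m)) (x : 'cV[R]_m) i :
  (A *m x) i 0 = (row i A *m x) 0 0.
Proof. by rewrite -row_mul [RHS]mxE. Qed.

Lemma mulmx_dotp k m (A : 'M[R]_(k, m)) x i :
  (A *m x) i 0 = dotp (row i A)^T x.
Proof. by rewrite /dotp trmxK mulmx_row. Qed.

Lemma quadform_dotp n (A : 'M[R]_n) x : quadform A x = dotp x (A *m x).
Proof. by rewrite /quadform /dotp mulmxA. Qed.

Lemma dotp_ge0 n (x y : 'cV[R]_n) : lev 0 x -> lev 0 y -> 0 <= dotp x y.
Proof.
move=> x0 y0; rewrite dotpE; apply: sumr_ge0 => i _.
by move: (x0 i) (y0 i); rewrite !mxE; apply: mulr_ge0.
Qed.

Lemma dotp_self_ge0 n (x : 'cV[R]_n) : 0 <= dotp x x.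
Proof. by rewrite dotpE; apply: sumr_ge0 => i _; rewrite -expr2 sqr_ge0. Qed.

Lemma dotp_delta n (x : 'cV[R]_n) i : dotp x (delta_mx i 0) = x i 0.
Proof.
rewrite dotpE (bigD1 i) //= big1 => [|j ji]; first by rewrite !mxE !eqxx mulr1 addr0.
by rewrite !mxE (negbTE ji) mulr0.
Qed.

Lemma lev0P n (x : 'cV[R]_n) : lev 0 x <-> forall i, 0 <= x i 0.
Proof. by split=> h i; move: (h i); rewrite mxE. Qed.

Lemma lev_sub n (x y : 'cV[R]_n) : lev x y <-> lev 0 (y - x).
Proof. by split=> h i; move: (h i); rewrite !mxE subr_ge0. Qed.

Lemma lev0_col_mx m k (x : 'cV[R]_m) (y : 'cV[R]_k) :
  lev 0 (col_mx x y) <-> lev 0 x /\ lev 0 y.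
Proof.
split=> [/lev0P h|[/lev0P hx /lev0P hy]].
  split; apply/lev0P => i; [have := h (lshift _ i)|have := h (rshift _ i)];
  by rewrite ?col_mxEu ?col_mxEd.
apply/lev0P => i; rewrite -(splitK i); case: (split i) => j /=;
by rewrite ?col_mxEu ?col_mxEd.
Qed.

Lemma lev0_anti n (x : 'cV[R]_n) : lev 0 x -> lev 0 (- x) -> x = 0.
Proof.
move=> /lev0P h1 /lev0P h2; apply/colP => i; rewrite [RHS]mxE.
by apply/eqP; rewrite eq_le h1 andbT -oppr_ge0; move: (h2 i); rewrite mxE.
Qed.

(** For small steps no nonzero coordinate of [u] changes sign. The product form treats both signs at
    once and asks nothing where [u] vanishes. *)
Lemma small_step n (u w : 'cV[R]_n) : exists2 e0 : R, 0 < e0 &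
  forall t : R, 0 <= t <= e0 -> forall l, 0 <= u l 0 * (u l 0 + t * w l 0).
Proof.
(* The summand 1 makes [s] invertible; where [u l 0] is zero the quotient is 0 by convention. *)
pose s := 1 + \sum_l `|w l 0| / `|u l 0|.
have s_ge l : `|w l 0| / `|u l 0| <= s.
  rewrite /s (bigD1 l) //= addrCA lerDl addr_ge0 //.
  by apply: sumr_ge0 => *; rewrite divr_ge0.
have s0 : 0 < s.
  by rewrite ltr_pwDl // sumr_ge0 // => *; rewrite divr_ge0.
exists s^-1 => [|t /andP[t0 ts] l]; first by rewrite invr_gt0.
have [->|u0] := eqVneq (u l 0) 0; first by rewrite mul0r.
have : t * `|w l 0| <= `|u l 0|.
  have := s_ge l; rewrite ler_pdivrMr ?normr_gt0 // => hw.
  apply: le_trans (_ : t * (s * `|u l 0|) <= _); first by rewrite ler_wpM2l.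
  by rewrite mulrA ler_piMl // -ler_pdivlMr // mul1r.
rewrite -{1}(ger0_norm t0) -normrM ler_norml => /andP[].
by case: (ger0P (u l 0)) => hu; nra.
Qed.

End DotProduct.

(** * Fourier-Motzkin elimination and the Farkas lemma *)

Section PolyhedralCone.
Variable R : realType.
Implicit Types (n k m p r : nat).

Definition polyhedral_cone n (P : set 'cV[R]_n) :=
  exists r (M : 'M[R]_(r, n)), forall x, P x <-> lev 0 (M *m x).

Lemma polyhedral_coneI n (P P' : set 'cV[R]_n) :
  polyhedral_cone P -> polyhedral_cone P' -> polyhedral_cone (P `&` P').
Proof.
move=> [r [M hM]] [r' [M' hM']]; exists (r + r')%N, (col_mx M M') => x.
rewrite mul_col_mx lev0_col_mx -hM -hM'; split=> -[]; by split.
Qed.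

Lemma polyhedral_cone_ge0 n r (M : 'M[R]_(r, n)) :
  polyhedral_cone [set x | lev 0 (M *m x)].
Proof. by exists r, M. Qed.

Lemma polyhedral_cone_eq0 n r (M : 'M[R]_(r, n)) :
  polyhedral_cone [set x | M *m x = 0].
Proof.
exists (r + r)%N, (col_mx M (- M)) => x.
rewrite mul_col_mx lev0_col_mx mulNmx; split=> [/= ->|[h h']].
  by rewrite oppr0; split=> i; rewrite !mxE.
exact: lev0_anti.
Qed.

Lemma ltr_between (I : finType) (P P' : pred I) (lo hi : I -> R) :
  (forall i j, P i -> P' j -> lo i <= hi j) ->
  exists t, (forall i, P i -> lo i <= t) /\ (forall j, P' j -> t <= hi j).
Proof.
move=> h; case: (pickP P) => [i0 Pi0|P0].
  case: (Order.TotalTheory.arg_maxP lo Pi0) => i Pi imax.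
  by exists (lo i); split=> [j /imax|j /(h _ _ Pi)].
case: (pickP P') => [j0 Pj0|P'0]; last first.
  by exists 0; split=> i; rewrite ?P0 ?P'0.
case: (Order.TotalTheory.arg_minP hi Pj0) => j Pj jmin.
by exists (hi j); split=> [i|i /jmin //]; rewrite P0.
Qed.

(* Fourier-Motzkin elimination of the variable [t]. *)
Lemma polyhedral_cone_elim n r (M : 'M[R]_(r, n)) (c : 'cV[R]_r) :
  polyhedral_cone [set x | exists t : R, lev 0 (M *m x + t *: c)].
Proof.
(* Rows with coefficients of opposite sign are combined so that [t] cancels, and rows free of [t]
   are kept. All other pairs give a zero row, so that the index set is simply the set of all
   pairs. *)
pose w (ab : 'I_r * 'I_r) : 'rV[R]_r :=
  let: (a, b) := ab in
  if (0 < c a 0) && (c b 0 < 0)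
  then c a 0 *: delta_mx 0 b - c b 0 *: delta_mx 0 a
  else if c a 0 == 0 then delta_mx 0 a else 0.
pose W := \matrix_(l < #|{: 'I_r * 'I_r}|) w (enum_val l).
exists #|{: 'I_r * 'I_r}|, (W *m M) => x.
have WE (u : 'cV[R]_r) : lev 0 (W *m u) <-> forall a b, 0 <= (w (a, b) *m u) 0 0.
  split=> [/lev0P h a b|h].
    by have := h (enum_rank (a, b)); rewrite (mulmx_row W) rowK enum_rankK.
  by apply/lev0P => l; rewrite (mulmx_row W) rowK; case: (enum_val l).
have wE u a b : (w (a, b) *m u) 0 0 =
    if (0 < c a 0) && (c b 0 < 0) then c a 0 * u b 0 - c b 0 * u a 0
    else if c a 0 == 0 then u a 0 else 0 :> R.
  rewrite /w; case: ifP => _.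
    by rewrite mulmxBl -!scalemxAl -!rowE !mxE.
  by case: ifP => _; rewrite ?mul0mx -?rowE mxE.
rewrite -mulmxA WE; split=> [[t /lev0P h] a b|h].
  rewrite wE; have := h a; have := h b; rewrite !mxE; set u := (\sum_j _); set v := \sum_j _.
  case: ifP => [/andP[ca cb]|_]; first by nra.
  by case: ifP => // /eqP ->; rewrite mulr0 addr0.
set u := M *m x in h *.
have [t [tlo thi]] : exists t, (forall a, 0 < c a 0 -> - u a 0 / c a 0 <= t) /\
    (forall b, c b 0 < 0 -> t <= u b 0 / - c b 0).
  apply: ltr_between => a b ca cb; have := h a b; rewrite wE ca cb /= => hab.
  by rewrite ler_pdivrMr // mulrAC ler_pdivlMr ?oppr_gt0 //; nra.
exists t; apply/lev0P => i; rewrite mxE [X in _ + X]mxE.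
case: (ltrgtP (c i 0) 0) => ci.
- by have := thi _ ci; rewrite ler_pdivlMr ?oppr_gt0 //; nra.
- by have := tlo _ ci; rewrite ler_pdivrMr //; nra.
- by rewrite ci mulr0 addr0; have := h i i; rewrite wE ci ltxx eqxx.
Qed.

Lemma polyhedral_cone_proj_mx n p r (M1 : 'M[R]_(r, n)) (M2 : 'M[R]_(r, p)) :
  polyhedral_cone [set x | exists y, lev 0 (M1 *m x + M2 *m y)].
Proof.
elim: p => [|p IHp] in r M1 M2 *.
  exists r, M1 => x; split=> [[y]|h]; last exists 0;
  by rewrite thinmx0 mul0mx addr0.
(* Viewing [p.+1] as [1 + p] splits off the first coordinate of [y] as a block; it is eliminated
   first, the others by induction. *)
change 'M[R]_(r, 1 + p) in M2.
change (polyhedral_cone [set x | exists y : 'cV_(1 + p), lev 0 (M1 *m x + M2 *m y)]).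
have [r' [N hN]] := polyhedral_cone_elim (row_mx M1 (rsubmx M2)) (lsubmx M2).
have [r'' [N' hN']] := IHp _ (lsubmx N) (rsubmx N).
exists r'', N' => x; rewrite -hN'.
have M2E t (y : 'cV[R]_p) :
    M2 *m col_mx t%:M y = rsubmx M2 *m y + t *: lsubmx M2.
  by rewrite -{1}(hsubmxK M2) mul_row_col mul_mx_scalar addrC.
have NE (y : 'cV[R]_p) : lev 0 (lsubmx N *m x + rsubmx N *m y) <->
    exists t, lev 0 (M1 *m x + M2 *m col_mx t%:M y).
  rewrite -mul_row_col hsubmxK -hN /=.
  by split=> -[t ht]; exists t; move: ht; rewrite M2E mul_row_col addrA.
split=> [[y hy]|[y /NE [t ht]]]; last by eexists; exact: ht.
exists (dsubmx y); apply/NE; exists (usubmx y 0 0).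
by rewrite -mx11_scalar vsubmxK.
Qed.

Lemma polyhedral_cone_proj n p (P : set 'cV[R]_(n + p)) : polyhedral_cone P ->
  polyhedral_cone [set x | exists y, P (col_mx x y)].
Proof.
move=> [r [M hM]].
have [r' [N hN]] := polyhedral_cone_proj_mx (lsubmx M) (rsubmx M).
exists r', N => x; rewrite -hN /=.
have hP y : P (col_mx x y) <-> lev 0 (lsubmx M *m x + rsubmx M *m y).
  by rewrite hM -mul_row_col hsubmxK.
by split=> -[y /hP hy]; exists y; rewrite // hP.
Qed.

(** The cone generated by the rows of [D] is a projection of a polyhedral cone, hence cut out by
    inequalities [N x >= 0]. Each row of [N] is nonnegative on the generators, so it is an
    admissible [z], and the hypothesis says that [c] satisfies its inequality. *)
Lemma farkas k m (D : 'M[R]_(k, m)) (c : 'cV[R]_m) :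
  (forall z, lev 0 (D *m z) -> 0 <= dotp c z) ->
  exists mu, lev 0 mu /\ D^T *m mu = c.
Proof.
move=> hc.
have [r [N hN]] : polyhedral_cone [set x | exists mu, lev 0 mu /\ D^T *m mu = x].
  have h := polyhedral_cone_proj (polyhedral_coneI
    (polyhedral_cone_ge0 (row_mx (0 : 'M[R]_(k, m)) 1%:M))
    (polyhedral_cone_eq0 (row_mx (- 1%:M) D^T))).
  case: h => r [N hN]; exists r, N => x; rewrite -hN /=.
  by split=> -[y [h1 h2]]; exists y; move: h1 h2;
    rewrite /= !mul_row_col mul0mx add0r mulNmx !mul1mx => h1 h2; split=> //;
    [rewrite h2 addNr | apply/eqP; rewrite -subr_eq0 addrC h2].
apply/hN/lev0P => l; rewrite mulmx_dotp dotpC; apply: hc.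
apply/lev0P => i; rewrite -dotp_delta dotpC dotp_mulmx dotpC -mulmx_dotp.
apply: (proj1 (lev0P _)); apply/hN; exists (delta_mx i 0); split=> // j.
by rewrite !mxE; case: (_ == _).
Qed.

(** Homogenization: [farkas] is applied to the cone of pairs [(y, t)] with [D y >= t b] and
    [t >= 0]. For [t > 0] one rescales to [t = 1]; for [t = 0], [y] is a recession direction, along
    which [c] cannot decrease. *)
Lemma affine_farkas k m (D : 'M[R]_(k, m)) (b : 'cV[R]_k) (c : 'cV[R]_m) g :
  (exists z, lev b (D *m z)) ->
  (forall z, lev b (D *m z) -> g <= dotp c z) ->
  exists mu, [/\ lev 0 mu, D^T *m mu = c & g <= dotp b mu].
Proof.
move=> [z0 hz0] hg.
have [mu [mu0]] : exists mu : 'cV[R]_(k + 1), lev 0 mu /\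
    (block_mx D (- b) 0 (1%:M : 'M[R]_1))^T *m mu = col_mx c (- g)%:M.
  apply: farkas => z; rewrite -(vsubmxK z); set y := usubmx z.
  rewrite [dsubmx z]mx11_scalar; set t := dsubmx z 0 0.
  rewrite mul_block_col mul0mx add0r mul1mx mulNmx mul_mx_scalar lev0_col_mx.
  rewrite dotp_col_mx => -[/lev0P hD /lev0P /(_ 0)]; rewrite mxE eqxx => t0.
  have -> : dotp (- g)%:M t%:M = - g * t.
    by rewrite dotpE big_ord1 !mxE eqxx.
  case: (ltrgtP t 0) => [|tp|t00]; first by rewrite ltNge t0.
    have := hg (t^-1 *: y); rewrite dotpZr.
    rewrite ler_pdivlMl // mulrC mulNr subr_ge0; apply => i.
    move: (hD i); rewrite -scalemxAr !mxE subr_ge0 => hi.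
    by rewrite ler_pdivlMl.
  rewrite t00 mulr0 addr0 leNgt; apply/negP => cy.
  have h s : 0 <= s -> g <= dotp c z0 + s * dotp c y.
    move=> s0; rewrite -dotpZr -dotpDr; apply: hg => i.
    rewrite mulmxDr -scalemxAr; move: (hD i) (hz0 i).
    rewrite t00 scale0r subr0 !mxE => h1 h2.
    by rewrite -[leLHS]addr0 lerD // mulr_ge0.
  have h0 : 0 <= dotp c z0 - g + 1 by have := hg _ hz0; lra.
  (* This step length brings the value down to exactly [g - 1]. *)
  have := h ((dotp c z0 - g + 1) / - dotp c y).
  rewrite divr_ge0 ?oppr_ge0 ?(ltW cy) // => /(_ isT).
  by rewrite invrN mulrN mulNr mulrVK ?unitfE ?lt_eqF //; lra.
rewrite tr_block_mx trmx0 trmx1 -(vsubmxK mu); move: mu0.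
rewrite -{1}(vsubmxK mu) lev0_col_mx => -[mu0 s0].
rewrite mul_block_col mul0mx addr0 mul1mx => /eq_col_mx [hc /matrixP/(_ 0 0)].
rewrite linearN /= mulNmx mxE [X in X + _]mxE -/(dotp b (usubmx mu)).
(* The last multiplier is the slack in [g <= dotp b mu]. *)
rewrite [RHS]mxE eqxx mulr1n => hs; exists (usubmx mu); split=> //.
move: (proj1 (lev0P _) s0 0) hs; set v := dsubmx _ _ _; set u := dotp _ _.
by move=> h1 h2; lra.
Qed.

End PolyhedralCone.

(** * The entrywise norm of a matrix *)

Section MatrixNorm.
Variable R : realType.
Implicit Types m n p : nat.

Definition mxnorm1 m n (M : 'M[R]_(m, n)) : R := \sum_i \sum_j `|M i j|.

Lemma mxnorm1_ge0 m n (M : 'M[R]_(m, n)) : 0 <= mxnorm1 M.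
Proof. by do 2![apply: sumr_ge0 => ? _]. Qed.

Lemma mxnorm1D m n (M N : 'M[R]_(m, n)) : mxnorm1 (M + N) <= mxnorm1 M + mxnorm1 N.
Proof.
rewrite -big_split; apply: ler_sum => i _; rewrite -big_split.
by apply: ler_sum => j _; rewrite mxE ler_normD.
Qed.

Lemma mxnorm1Z m n t (M : 'M[R]_(m, n)) : mxnorm1 (t *: M) = `|t| * mxnorm1 M.
Proof.
rewrite mulr_sumr; apply: eq_bigr => i _; rewrite mulr_sumr.
by apply: eq_bigr => j _; rewrite mxE normrM.
Qed.

Lemma mxnorm1_tr m n (M : 'M[R]_(m, n)) : mxnorm1 M^T = mxnorm1 M.
Proof.
by rewrite /mxnorm1 exchange_big; do 2![apply: eq_bigr => ? _]; rewrite mxE.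
Qed.

Lemma mxnorm1M m n p (M : 'M[R]_(m, n)) (N : 'M[R]_(n, p)) :
  mxnorm1 (M *m N) <= mxnorm1 M * mxnorm1 N.
Proof.
rewrite mulr_suml; apply: ler_sum => i _.
apply: (@le_trans _ _ (\sum_k \sum_j `|M i j| * `|N j k|)).
  apply: ler_sum => k _; rewrite mxE; apply: le_trans (ler_norm_sum _ _ _) _.
  by apply: ler_sum => j _; rewrite normrM.
rewrite exchange_big mulr_suml; apply: ler_sum => j _.
rewrite -mulr_sumr ler_wpM2l // /mxnorm1 (bigD1 j) //= lerDl.
by do 2![apply: sumr_ge0 => ? _].
Qed.

Lemma mxnorm1_cV n (x : 'cV[R]_n) : mxnorm1 x = \sum_i `|x i 0|.
Proof. by apply: eq_bigr => i _; rewrite big_ord1. Qed.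

Lemma dotp_le_mxnorm1 n (x y : 'cV[R]_n) : `|dotp x y| <= mxnorm1 x * mxnorm1 y.
Proof.
rewrite -(mxnorm1_tr x); apply: le_trans (mxnorm1M _ _).
by rewrite /mxnorm1 !big_ord1.
Qed.

Lemma quadform_le_mxnorm1 n (M : 'M[R]_n) x :
  `|quadform M x| <= mxnorm1 M * dotp x x.
Proof.
rewrite quadform_dotp dotpE; apply: le_trans (ler_norm_sum _ _ _) _.
rewrite mulr_suml; apply: ler_sum => i _.
rewrite mxE mulr_sumr mulr_suml; apply: le_trans (ler_norm_sum _ _ _) _.
apply: ler_sum => j _; rewrite mulrCA normrM ler_wpM2l //.
(* A product of two coordinates is at most the mean of their squares in absolute value. *)
have sq_le l : x l 0 ^+ 2 <= dotp x x.
  rewrite dotpE (bigD1 l) //= -expr2 lerDl.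
  by apply: sumr_ge0 => *; rewrite -expr2 sqr_ge0.
have := sq_le i; have := sq_le j; rewrite ler_norml => h1 h2.
by have := sqr_ge0 (x i 0 - x j 0); have := sqr_ge0 (x i 0 + x j 0);
  rewrite sqrrD sqrrB => h3 h4; apply/andP; split; lra.
Qed.

End MatrixNorm.

(** * Piecewise quadratic functions on a convex set *)

Section PiecewiseQuadratic.
Variables (R : realType) (n r : nat) (A : 'M[R]_(r, n)).
Variables (T : finType) (K : T -> {set 'I_r}).
Variables (Th : T -> 'M[R]_n) (c : T -> 'cV[R]_n) (e : T -> R).
Variable f : 'cV[R]_n -> R.

(** All pieces share one list of hyperplanes, the rows of [A]; [bent] and the count of crossed
    hyperplanes refer to that common list. *)
Definition piece i : set 'cV[R]_n :=
  [set x | forall l, l \in K i -> 0 <= (A *m x) l 0].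

Let theta i x := quadform (Th i) x + dotp (c i) x + e i.
Hypothesis f_piece : forall i x, piece i x -> f x = theta i x.

(** The derivative of [theta i] at [z] along [d]; there are two bilinear terms because [Th i] may
    fail to be symmetric. *)
Let grad i z d := dotp z (Th i *m d) + dotp d (Th i *m z) + dotp (c i) d.

Let theta_line i z d t :
  theta i (z + t *: d) = theta i z + t * grad i z d + t ^+ 2 * quadform (Th i) d.
Proof.
by rewrite /theta /grad !quadform_dotp mulmxDr -scalemxAr !dotp_linE; ring.
Qed.

Let C1 := \sum_i (2 * mxnorm1 (Th i) + mxnorm1 (c i)).

Let C1_ge i : 2 * mxnorm1 (Th i) + mxnorm1 (c i) <= C1.
Proof.
rewrite /C1 (bigD1 i) //= lerDl; apply: sumr_ge0 => j _.
by rewrite addr_ge0 ?mulr_ge0 ?mxnorm1_ge0.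
Qed.

Let C1_ge0 : 0 <= C1.
Proof. by apply: sumr_ge0 => j _; rewrite addr_ge0 ?mulr_ge0 ?mxnorm1_ge0. Qed.

Let quadform_le_C1 i d : `|quadform (Th i) d| <= C1 * dotp d d.
Proof.
apply: le_trans (quadform_le_mxnorm1 _ _) _.
rewrite ler_wpM2r ?dotp_self_ge0 //; apply: le_trans (C1_ge i).
by have := mxnorm1_ge0 (Th i); have := mxnorm1_ge0 (c i); lra.
Qed.

Let grad_le i z d : `|grad i z d| <= C1 * (1 + mxnorm1 z) * mxnorm1 d.
Proof.
have h1 : `|dotp z (Th i *m d)| <= mxnorm1 z * (mxnorm1 (Th i) * mxnorm1 d).
  apply: le_trans (dotp_le_mxnorm1 _ _) _.
  by rewrite ler_wpM2l ?mxnorm1_ge0 // mxnorm1M.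
have h2 : `|dotp d (Th i *m z)| <= mxnorm1 d * (mxnorm1 (Th i) * mxnorm1 z).
  apply: le_trans (dotp_le_mxnorm1 _ _) _.
  by rewrite ler_wpM2l ?mxnorm1_ge0 // mxnorm1M.
have h3 := dotp_le_mxnorm1 (c i) d.
apply: (@le_trans _ _ ((2 * mxnorm1 (Th i) + mxnorm1 (c i)) *
  (1 + mxnorm1 z) * mxnorm1 d)); last first.
  by rewrite !ler_wpM2r ?addr_ge0 ?mxnorm1_ge0.
apply: le_trans (ler_normD _ _) _; apply: le_trans (lerD (ler_normD _ _) h3) _.
have d0 := mxnorm1_ge0 d; have z0 := mxnorm1_ge0 z.
have T0 := mxnorm1_ge0 (Th i); have c0 := mxnorm1_ge0 (c i).
have := mulr_ge0 T0 d0; have := mulr_ge0 (mulr_ge0 c0 z0) d0; lra.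
Qed.

(** Rows outside [L] are zeroed rather than deleted: the kernel is the intersection of the
    hyperplanes in [L], and the row indices stay those of [A]. *)
Let active_rows (L : {set 'I_r}) : 'M[R]_(r, n) :=
  \matrix_(l, j) (A l j *+ (l \in L)).

Let C2 := \sum_L mxnorm1 (pinvmx (active_rows L)).

Let C2_ge0 : 0 <= C2.
Proof. by apply: sumr_ge0 => *; apply: mxnorm1_ge0. Qed.

Let active_rowsE (L : {set 'I_r}) (x : 'cV[R]_n) l :
  (active_rows L *m x) l 0 = (A *m x) l 0 *+ (l \in L).
Proof.
by rewrite !mxE -sumrMnl; apply: eq_bigr => j _; rewrite mxE mulrnAl.
Qed.

(** A Hoffman-type error bound. With [B := active_rows L], the generalized inverse projects [d] into
    the kernel of [B], and the part removed is linear in [B *m d]. Summing over the finitely many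
    [L] makes the constant uniform. *)
Let hoffman (L : {set 'I_r}) (d : 'cV[R]_n) :
  exists d0, (forall l, l \in L -> (A *m d0) l 0 = 0) /\
  mxnorm1 (d - d0) <= C2 * \sum_(l in L) `|(A *m d) l 0|.
Proof.
pose B := active_rows L.
exists (d - pinvmx B *m (B *m d)); split=> [l lL|].
  have : (B *m (d - pinvmx B *m (B *m d))) l 0 = 0.
    by rewrite mulmxBr (mulmxA B) (mulmxA _ B) mulmxKpV // subrr mxE.
  by rewrite active_rowsE lL.
rewrite opprB addrC subrK; apply: le_trans (mxnorm1M _ _) _.
rewrite [mxnorm1 (B *m d)]mxnorm1_cV [in leRHS]big_mkcond /=.
have -> : \sum_i `|(B *m d) i 0| =
    \sum_l (if l \in L then `|(A *m d) l 0| else 0).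
  apply: eq_bigr => l _; rewrite active_rowsE.
  by case: (l \in L); rewrite ?normr0.
rewrite ler_wpM2r //.
  by apply: sumr_ge0 => l _; case: ifP.
rewrite /C2 (bigD1 L) //= lerDl; apply: sumr_ge0 => *; exact: mxnorm1_ge0.
Qed.

Let A_line (z d : 'cV[R]_n) t l :
  (A *m (z + t *: d)) l 0 = (A *m z) l 0 + t * (A *m d) l 0.
Proof. by rewrite mulmxDr -scalemxAr mxE [X in _ + X]mxE. Qed.

(** Split [d] as [d0 + (d - d0)] with [d0] tangent to all hyperplanes through [z]. Short steps along
    [d0] and [- d0] stay in both pieces, where the two quadratics agree, so their slopes along [d0]
    coincide. The remainder is controlled by [hoffman] and [grad_le]. *)
Let kink i j z d : piece i z -> piece j z ->
  `|grad i z d - grad j z d| <=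
  2 * (C1 * C2) * (1 + mxnorm1 z) * \sum_(l | (A *m z) l 0 == 0) `|(A *m d) l 0|.
Proof.
move=> iz jz; pose L : {set 'I_r} := [set l | (A *m z) l 0 == 0]%SET.
have [d0 [Ad0 hd]] := hoffman L d.
have [e0 e0p he0] := small_step (A *m z) (A *m d0).
have [e1 e1p he1] := small_step (A *m z) (A *m - d0).
have stay q d' t : piece q z -> (forall l, l \in L -> (A *m d') l 0 = 0) ->
    (forall l, 0 <= (A *m z) l 0 * ((A *m z) l 0 + t * (A *m d') l 0)) ->
    piece q (z + t *: d').
  move=> qz hd' hl l lK; rewrite A_line.
  have := qz _ lK; have := hl l.
  have [zl _ _|zl] := eqVneq ((A *m z) l 0) 0.
    by rewrite zl hd' ?inE ?zl // mulr0 addr0.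
  by move=> + z0; rewrite pmulr_rge0 // lt_neqAle eq_sym zl.
have Ad0N l : l \in L -> (A *m - d0) l 0 = 0.
  by move=> lL; rewrite mulmxN mxE Ad0 // oppr0.
pose t := Num.min e0 e1.
have tp : 0 < t by rewrite lt_min e0p.
have t0 : 0 <= t <= e0 by rewrite ltW // ge_min lexx.
have t1 : 0 <= t <= e1 by rewrite ltW // ge_min lexx orbT.
have E1 : theta i (z + t *: d0) = theta j (z + t *: d0).
  by rewrite -!f_piece //; apply: stay => // l; exact: he0.
have E2 : theta i (z + t *: - d0) = theta j (z + t *: - d0).
  by rewrite -!f_piece //; apply: stay => // l; exact: he1.
have E0 : grad i z d0 = grad j z d0.
  have gN q : grad q z (- d0) = - grad q z d0.
    by rewrite /grad mulmxN !dotp_linE; ring.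
  have qN q : quadform (Th q) (- d0) = quadform (Th q) d0.
    by rewrite !quadform_dotp mulmxN !dotp_linE; ring.
  (* Subtracting the two equalities cancels the second-order terms. *)
  move: E1 E2; rewrite !theta_line !gN !qN -!f_piece // => E1 E2.
  have : t * (grad i z d0 - grad j z d0) = 0 by lra.
  by move/eqP; rewrite mulf_eq0 gt_eqF //= subr_eq0 => /eqP.
have gB q : grad q z d = grad q z d0 + grad q z (d - d0).
  rewrite -[in LHS](subrKC d0 d); move: (d - d0) => d1.
  by rewrite /grad mulmxDr !dotp_linE; ring.
rewrite !gB E0 opprD addrACA subrr add0r.
apply: le_trans (ler_normB _ _) _.
have hS : \sum_(l in L) `|(A *m d) l 0| =
    \sum_(l | (A *m z) l 0 == 0) `|(A *m d) l 0|.
  by apply: eq_bigl => l; rewrite inE.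
rewrite hS in hd; set S := \sum_(l | _) _ in hd *.
have := grad_le i z (d - d0); have := grad_le j z (d - d0).
have : C1 * (1 + mxnorm1 z) * mxnorm1 (d - d0) <= C1 * (1 + mxnorm1 z) * (C2 * S).
  by rewrite ler_wpM2l ?mulr_ge0 ?addr_ge0 ?mxnorm1_ge0.
set X := C1 * _ * mxnorm1 _; set a := `|grad i _ _|; set b := `|grad j _ _|.
rewrite (_ : 2 * (C1 * C2) * _ * S = 2 * (C1 * (1 + mxnorm1 z) * (C2 * S))); last ring.
lra.
Qed.

(* Each term has across its hyperplane a kink proportional to [1 + mxnorm1 x],
   the growth rate of the gradients of the pieces. *)
Definition bent (x : 'cV[R]_n) : R :=
  \sum_l (`|(A *m x) l 0| + (1 + mxnorm1 x)) ^+ 2 + dotp x x.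

Let term (l : 'I_r) (x : 'cV[R]_n) : R := `|(A *m x) l 0| + (1 + mxnorm1 x).

Let term_ge0 l x : 0 <= term l x.
Proof. by rewrite /term !addr_ge0 ?mxnorm1_ge0. Qed.

Let comb (x y : 'cV[R]_n) t := (1 - t) *: x + t *: y.

Let combE x y t : comb x y t = x + t *: (y - x).
Proof. by rewrite /comb scalerBl scale1r scalerBr -addrA (addrC (- _)). Qed.

Let term_comb l x y t : 0 <= t <= 1 ->
  term l (comb x y t) <= (1 - t) * term l x + t * term l y.
Proof.
move=> /andP[t0 t1]; have t1' : 0 <= 1 - t by rewrite subr_ge0.
have h1 : `|(A *m comb x y t) l 0| <= (1 - t) * `|(A *m x) l 0| + t * `|(A *m y) l 0|.
  rewrite /comb mulmxDr -!scalemxAr mxE [X in X + _]mxE [X in _ + X]mxE.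
  by apply: le_trans (ler_normD _ _) _; rewrite !normrM (ger0_norm t0) (ger0_norm t1').
have h2 : mxnorm1 (comb x y t) <= (1 - t) * mxnorm1 x + t * mxnorm1 y.
  by apply: le_trans (mxnorm1D _ _) _; rewrite !mxnorm1Z (ger0_norm t0) (ger0_norm t1').
rewrite /term; lra.
Qed.

Let term2_comb l x y t : 0 <= t <= 1 ->
  term l (comb x y t) ^+ 2 <= (1 - t) * term l x ^+ 2 + t * term l y ^+ 2.
Proof.
move=> t01; have := term_comb l x y t01.
rewrite -(@ler_pXn2r _ 2) ?nnegrE ?term_ge0 //; last first.
  by case/andP: t01 => t0 t1; rewrite addr_ge0 ?mulr_ge0 ?term_ge0 ?subr_ge0.
move/le_trans; apply; rewrite -subr_ge0.
rewrite (_ : _ - _ = t * (1 - t) * (term l x - term l y) ^+ 2); last ring.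
by case/andP: t01 => t0 t1; rewrite mulr_ge0 ?sqr_ge0 // mulr_ge0 ?subr_ge0.
Qed.

Let dotp_comb x y t :
  dotp (comb x y t) (comb x y t) =
  (1 - t) * dotp x x + t * dotp y y - t * (1 - t) * dotp (y - x) (y - x).
Proof. by rewrite /comb !dotp_linE (dotpC y x); ring. Qed.

(** Squares of nonnegative convex functions are convex; the strong convexity comes from the summand
    [dotp x x] and will absorb the curvature of the pieces. *)
Let bent_comb x y t : 0 <= t <= 1 ->
  bent (comb x y t) <=
  (1 - t) * bent x + t * bent y - t * (1 - t) * dotp (y - x) (y - x).
Proof.
move=> t01; rewrite /bent dotp_comb.
have : \sum_l term l (comb x y t) ^+ 2 <=
    (1 - t) * \sum_l term l x ^+ 2 + t * \sum_l term l y ^+ 2.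
  by rewrite !mulr_sumr -big_split; apply: ler_sum => l _; exact: term2_comb.
rewrite /term; lra.
Qed.

(** For a hyperplane through [z], the absolute value at both [z + t *: d] and [z - t *: d] is [t]
    times that at [d], and the cross terms of the two squares give a gain linear in [t] with weight
    [1 + mxnorm1 z]. The other squares contribute at least 0 by midpoint convexity. *)
Let bent_second_diff z d t : 0 <= t ->
  4 * t * (1 + mxnorm1 z) * (\sum_(l | (A *m z) l 0 == 0) `|(A *m d) l 0|) +
  2 * t ^+ 2 * dotp d d <= bent (z + t *: d) + bent (z - t *: d) - 2 * bent z.
Proof.
move=> t0.
have mid l : 2 * term l z ^+ 2 <= term l (z + t *: d) ^+ 2 + term l (z - t *: d) ^+ 2.
  have := @term2_comb l (z + t *: d) (z - t *: d) 2^-1.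
  have -> : comb (z + t *: d) (z - t *: d) 2^-1 = z.
    rewrite /comb (_ : 1 - 2^-1 = 2^-1); last lra.
    rewrite -scalerDr addrACA subrr addr0 -mulr2n -scaler_nat scalerA.
    by rewrite mulVf ?scale1r.
  by move=> /(_ ltac:(lra)) ?; lra.
have mid_norm : 2 * mxnorm1 z <= mxnorm1 (z + t *: d) + mxnorm1 (z - t *: d).
  apply: le_trans (mxnorm1D _ _).
  by rewrite addrACA subrr addr0 -mulr2n -scaler_nat mxnorm1Z ger0_norm.
have sharp l : (A *m z) l 0 == 0 ->
    2 * term l z ^+ 2 + 4 * t * (1 + mxnorm1 z) * `|(A *m d) l 0| <=
    term l (z + t *: d) ^+ 2 + term l (z - t *: d) ^+ 2.
  move/eqP => zl.
  have ED : (A *m (z + t *: d)) l 0 = t * (A *m d) l 0.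
    by rewrite A_line zl add0r.
  have EB : (A *m (z - t *: d)) l 0 = - (t * (A *m d) l 0).
    by rewrite -scaleNr A_line zl add0r mulNr.
  rewrite /term ED EB zl normrN normr0 add0r normrM (ger0_norm t0).
  have := mid_norm; have := mxnorm1_ge0 z.
  have := mulr_ge0 t0 (normr_ge0 ((A *m d) l 0)); set ta := t * _.
  set N0 := mxnorm1 z; set N1 := mxnorm1 (_ + _); set N2 := mxnorm1 (_ - _).
  move=> ta0 N0p hN.
  have sq : 2 * (1 + N0) ^+ 2 <= (1 + N1) ^+ 2 + (1 + N2) ^+ 2.
    by have := sqr_ge0 (N1 - N2); nra.
  rewrite -subr_ge0 (_ : _ - _ = 2 * ta ^+ 2 + 2 * (ta * (N1 + N2 - 2 * N0))
    + ((1 + N1) ^+ 2 + (1 + N2) ^+ 2 - 2 * (1 + N0) ^+ 2)); last by rewrite /ta; ring.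
  have := sqr_ge0 ta; have : 0 <= ta * (N1 + N2 - 2 * N0) by rewrite mulr_ge0 // subr_ge0.
  lra.
have -> : bent (z + t *: d) + bent (z - t *: d) - 2 * bent z =
    \sum_l (term l (z + t *: d) ^+ 2 + term l (z - t *: d) ^+ 2
            - 2 * term l z ^+ 2) + 2 * t ^+ 2 * dotp d d.
  rewrite sumrB big_split -mulr_sumr /= /bent !dotp_linE (dotpC d z).
  by rewrite /term; ring.
rewrite lerD2r mulr_sumr big_mkcond; apply: ler_sum => l _.
case: ifP => [/sharp|_]; last by rewrite subr_ge0 mid.
by rewrite -/(term l z); lra.
Qed.

(** [C1] pays for the curvature of the pieces, [C1 * C2] for the jump of the gradient between
    them. *)
Let C := C1 + C1 * C2.

Let g (x : 'cV[R]_n) : R := f x + C * bent x.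

Let C_ge0 : 0 <= C.
Proof. by rewrite addr_ge0 ?mulr_ge0. Qed.

Let second_diff_ge0 i j z d t : 0 <= t -> piece i z -> piece j z ->
  piece i (z + t *: d) -> piece j (z - t *: d) ->
  2 * g z <= g (z + t *: d) + g (z - t *: d).
Proof.
move=> t0 iz jz izd jzd; rewrite /g (f_piece izd) (f_piece jzd) -scalerN !theta_line.
rewrite -!f_piece //.
have gN q : grad q z (- d) = - grad q z d.
  by rewrite /grad mulmxN !dotp_linE; ring.
have qN q : quadform (Th q) (- d) = quadform (Th q) d.
  by rewrite !quadform_dotp mulmxN !dotp_linE; ring.
rewrite gN qN scalerN.
have := ler_wpM2l C_ge0 (bent_second_diff z d t0).
have := kink d iz jz; have := quadform_le_C1 i d; have := quadform_le_C1 j d.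
have : 0 <= \sum_(l | (A *m z) l 0 == 0) `|(A *m d) l 0| by apply: sumr_ge0.
set S := \sum_(l | _) _ => S0.
rewrite !ler_norml => /andP[qj _] /andP[qi _] /andP[k _].
have h1 := ler_wpM2l (sqr_ge0 t) (lerD qi qj).
have h2 := ler_wpM2l t0 k.
set B := bent (_ + _) + bent _ - _ => hB.
have h3 : 0 <= C1 * (t * ((1 + mxnorm1 z) * S)).
  by rewrite !mulr_ge0 ?addr_ge0 ?mxnorm1_ge0.
have h3' : 0 <= C1 * C2 * (t * ((1 + mxnorm1 z) * S)).
  by rewrite !mulr_ge0 ?addr_ge0 ?mxnorm1_ge0.
have h4 : 0 <= C1 * C2 * (t ^+ 2 * dotp d d).
  by rewrite !mulr_ge0 ?sqr_ge0 ?dotp_self_ge0.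
have hB' : C * B = C * (bent (z + t *: d) + bent (z - t *: d)) - 2 * (C * bent z).
  by rewrite /B; ring.
rewrite hB' {hB'} in hB.
rewrite {1}/C in hB; nra.
Qed.

Variable S : set 'cV[R]_n.
Hypothesis S_convex : forall x y t, S x -> S y -> 0 <= t <= 1 -> S (comb x y t).
Hypothesis S_cover : forall x, S x -> exists i, piece i x.

(** The midpoint lies in some piece. Two numbers of the same weak sign with a nonnegative sum are
    both nonnegative, so both endpoints lie in that piece too. *)
Let same_piece x y : S x -> S y ->
  (forall l, 0 <= (A *m x) l 0 * (A *m y) l 0) ->
  exists i, piece i x /\ piece i y.
Proof.
move=> Sx Sy h; have t01 : 0 <= (2^-1 : R) <= 1 by lra.
have [i hi] := S_cover (S_convex Sx Sy t01); exists i.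
have {}hi l : l \in K i -> 0 <= (A *m x) l 0 /\ 0 <= (A *m y) l 0.
  move=> /hi; rewrite /comb mulmxDr -!scalemxAr mxE [X in X + _]mxE [X in _ + X]mxE.
  have := h l; set a := (A *m x) l 0; set b := (A *m y) l 0 => hab hs.
  split; rewrite leNgt; apply/negP => neg; nra.
by split=> l /hi [].
Qed.

Let convex_same_piece i x y t : 0 <= t <= 1 -> piece i x -> piece i y ->
  g (comb x y t) <= (1 - t) * g x + t * g y.
Proof.
move=> t01 ix iy.
have ixy : piece i (comb x y t).
  move=> l lK; rewrite /comb mulmxDr -!scalemxAr mxE [X in X + _]mxE [X in _ + X]mxE.
  by case/andP: t01 => t0 t1; rewrite addr_ge0 // mulr_ge0 ?subr_ge0 ?ix ?iy.
rewrite /g !(f_piece ix, f_piece iy, f_piece ixy).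
have := ler_wpM2l C_ge0 (bent_comb x y t01).
have := quadform_le_C1 i (y - x); rewrite ler_norml => /andP[q _].
have ttp : 0 <= t * (1 - t) by case/andP: t01 => *; rewrite mulr_ge0 ?subr_ge0.
have := ler_wpM2l ttp q.
have h4 : 0 <= C1 * C2 * (t * (1 - t) * dotp (y - x) (y - x)).
  by apply: mulr_ge0; rewrite mulr_ge0 ?dotp_self_ge0.
have -> : theta i (comb x y t) = (1 - t) * theta i x + t * theta i y
    - t * (1 - t) * quadform (Th i) (y - x).
  by have := theta_line i x (y - x) 1; rewrite scale1r subrKC combE theta_line => ->; ring.
have : C * (t * (1 - t) * dotp (y - x) (y - x)) =
    C1 * (t * (1 - t) * dotp (y - x) (y - x)) +
    C1 * C2 * (t * (1 - t) * dotp (y - x) (y - x)) by rewrite /C; ring.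
by move: C => C'; lra.
Qed.
(** Convexity on the two halves of a segment extends to the whole once a single second difference at
    the junction [z] is nonnegative. The points [z - s (y - x)] and [z + s (y - x)] lie on the two
    halves, so their values are bounded by chords; this forces [g z] below the chord from [x] to
    [y]. *)
Let chord_glue x y z u t : 0 < u < 1 -> z = comb x y u ->
  (forall t, 0 <= t <= 1 -> g (comb x z t) <= (1 - t) * g x + t * g z) ->
  (forall t, 0 <= t <= 1 -> g (comb z y t) <= (1 - t) * g z + t * g y) ->
  (exists2 s, 0 < s <= Num.min u (1 - u) &
     2 * g z <= g (z + s *: (y - x)) + g (z - s *: (y - x))) ->
  0 <= t <= 1 -> g (comb x y t) <= (1 - t) * g x + t * g y.
Proof.
move=> /andP[u0 u1] zE xz zy [s /andP[s0]]; rewrite le_min => /andP[su s1u] gz.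
have u1' : 0 < 1 - u by rewrite subr_gt0.
have gz_le : g z <= (1 - u) * g x + u * g y.
  have := zy (s / (1 - u)); rewrite divr_ge0 ?(ltW s0) ?(ltW u1') //=.
  rewrite ler_pdivrMr // mul1r s1u => /(_ isT).
  have -> : comb z y (s / (1 - u)) = z + s *: (y - x).
    by rewrite zE /comb; apply/colP => j; rewrite !mxE; field; rewrite gt_eqF.
  have := xz ((u - s) / u); rewrite divr_ge0 ?subr_ge0 ?(ltW u0) //=.
  rewrite ler_pdivrMr // mul1r gerBl (ltW s0) => /(_ isT).
  have -> : comb x z ((u - s) / u) = z - s *: (y - x).
    by rewrite zE /comb; apply/colP => j; rewrite !mxE; field; rewrite gt_eqF.
  rewrite (_ : (u - s) / u = 1 - s / u); last by field; rewrite gt_eqF.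
  set a := s / u; set b := s / (1 - u) => h1 h2.
  have h3 : 0 <= a * (g x - g z) + b * (g y - g z) by lra.
  (* Multiplying by [u (1 - u)] clears both denominators. *)
  have h4 : 0 <= s * ((1 - u) * (g x - g z) + u * (g y - g z)).
    rewrite (_ : _ * _ = u * (1 - u) * (a * (g x - g z) + b * (g y - g z))).
      by rewrite !mulr_ge0 // ltW.
    by rewrite /a /b; field; rewrite !gt_eqF.
  by rewrite pmulr_rge0 // in h4; lra.
move=> /andP[t0 t1]; have [tu|ut] := lerP t u.
  have := xz (t / u); rewrite divr_ge0 ?(ltW u0) //= ler_pdivrMr // mul1r tu.
  move=> /(_ isT).
  have -> : comb x z (t / u) = comb x y t.
    by rewrite zE /comb; apply/colP => j; rewrite !mxE; field; rewrite gt_eqF.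
  move=> /le_trans; apply; have tu0 : 0 <= t / u by rewrite divr_ge0 // ltW.
  have := ler_wpM2l tu0 gz_le; set a := t / u => h.
  have ta : t = a * u by rewrite /a mulrVK // unitfE gt_eqF.
  by rewrite ta; lra.
(* On the second half the point has parameter [1 - a] when measured from [z] to [y]. *)
pose a := (1 - t) / (1 - u).
have ta : 1 - t = a * (1 - u) by rewrite /a mulrVK // unitfE gt_eqF.
have a01 : 0 <= 1 - a <= 1.
  rewrite subr_ge0 gerBl divr_ge0 ?subr_ge0 ?(ltW u1) // ler_pdivrMr // mul1r.
  by rewrite lerD2l lerN2 ltW.
have := zy _ a01.
have -> : comb z y (1 - a) = comb x y t.
    by rewrite zE /comb; apply/colP => j; rewrite /a !mxE; field; rewrite gt_eqF.
move=> /le_trans; apply.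
have a0 : 0 <= a by rewrite divr_ge0 ?subr_ge0 // ltW.
have := ler_wpM2l a0 gz_le; have -> : t = 1 - a * (1 - u) by lra.
lra.
Qed.

Let sign_changes (x y : 'cV[R]_n) : {set 'I_r} :=
  [set l | (A *m x) l 0 * (A *m y) l 0 < 0]%SET.

Let A_comb x y t l :
  (A *m comb x y t) l 0 = (1 - t) * (A *m x) l 0 + t * (A *m y) l 0.
Proof. by rewrite /comb mulmxDr -!scalemxAr mxE [X in X + _]mxE [X in _ + X]mxE. Qed.

(** A hyperplane that strictly separates an interior point of the segment from an endpoint already
    separates the endpoints; [l] itself drops out because the interior point lies on it. *)
Let crossing x y u l : 0 < u < 1 -> l \in sign_changes x y ->
  (A *m comb x y u) l 0 = 0 ->
  (#|sign_changes x (comb x y u)| < #|sign_changes x y|)%N /\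
  (#|sign_changes (comb x y u) y| < #|sign_changes x y|)%N.
Proof.
move=> /andP[u0 u1] lxy lz; split; apply/proper_card/properP; split;
  try by exists l; rewrite // inE lz ?mulr0 ?mul0r ltxx.
  apply/fintype.subsetP => l'; rewrite !inE A_comb.
  by have := sqr_ge0 ((A *m x) l' 0); nra.
apply/fintype.subsetP => l'; rewrite !inE A_comb.
by have := sqr_ge0 ((A *m y) l' 0); nra.
Qed.

(** Near [z] the segment meets no hyperplane other than those through [z], so on each side [z]
    shares a piece with its neighbour and [second_diff_ge0] applies. *)
Let second_diff_small x y u : S x -> S y -> 0 < u < 1 ->
  exists2 s, 0 < s <= Num.min u (1 - u) &
    2 * g (comb x y u) <= g (comb x y u + s *: (y - x)) + g (comb x y u - s *: (y - x)).
Proof.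
move=> Sx Sy /andP[u0 u1]; set z := comb x y u.
have [e0 e0p he0] := small_step (A *m z) (A *m (y - x)).
have [e1 e1p he1] := small_step (A *m z) (A *m - (y - x)).
pose s := Num.min (Num.min e0 e1) (Num.min u (1 - u)).
have s0 : 0 < s by rewrite !lt_min e0p e1p u0 subr_gt0.
have [[se0 se1] [su s1u]] : (s <= e0 /\ s <= e1) /\ (s <= u /\ s <= 1 - u).
  by rewrite /s !ge_min !lexx !orbT.
exists s; first by rewrite s0 /s ge_min lexx orbT.
have zE t : z + t *: (y - x) = comb x y (u + t).
  by rewrite /z /comb; apply/colP => j; rewrite !mxE; ring.
have Sz : S z by apply: S_convex => //; rewrite !ltW.
have [i [iz izs]] : exists i, piece i z /\ piece i (z + s *: (y - x)).
  apply: same_piece => // [|l].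
    by rewrite zE; apply: S_convex => //; apply/andP; split; lra.
  by rewrite (A_line z (y - x)); apply: he0; rewrite ltW.
have [j [jz jzs]] : exists i, piece i z /\ piece i (z - s *: (y - x)).
  apply: same_piece => // [|l].
    by rewrite -scaleNr zE; apply: S_convex => //; apply/andP; split; lra.
  by rewrite -scalerN (A_line z (- (y - x))); apply: he1; rewrite ltW.
exact: (second_diff_ge0 (ltW s0) iz jz izs jzs).
Qed.

Let piecewise_quadratic_convex x y t : S x -> S y -> 0 <= t <= 1 ->
  g (comb x y t) <= (1 - t) * g x + t * g y.
Proof.
have [N] := ubnP #|sign_changes x y|; elim: N => // N IH in x y t *.
rewrite ltnS => leN Sx Sy t01.
have [sc0|[l lxy]] := set_0Vmem (sign_changes x y).
  have [|i [ix iy]] := same_piece Sx Sy; last exact: convex_same_piece ix iy.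
  by move=> l; move/setP/(_ l): sc0; rewrite !inE ltNge => /negbFE.
set a := (A *m x) l 0; set b := (A *m y) l 0.
have ab : a * b < 0 by move: lxy; rewrite inE.
(* The parameter at which the segment meets hyperplane [l], the root of [(1 - u) a + u b]. *)
pose u := a / (a - b).
have ab0 : a - b != 0 by apply/eqP => h; have := sqr_ge0 a; nra.
have u01 : 0 < u < 1.
  have sq : 0 < (a - b) ^+ 2 by rewrite lt_neqAle sqr_ge0 eq_sym sqrf_eq0 ab0.
  have E : u * (a - b) ^+ 2 = a * (a - b) by rewrite /u; field.
  have h1 : 0 < u * (a - b) ^+ 2 by rewrite E; have := sqr_ge0 a; nra.
  have h2 : 0 < (1 - u) * (a - b) ^+ 2.
    by rewrite mulrBl E; have := sqr_ge0 b; nra.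
  by move: h1 h2; rewrite !(pmulr_lgt0 _ sq) subr_gt0 => -> ->.
have lz : (A *m comb x y u) l 0 = 0 by rewrite A_comb -/a -/b /u; field.
have [xz zy] := crossing u01 lxy lz.
have Sz : S (comb x y u).
  by apply: S_convex => //; case/andP: u01 => h1 h2; rewrite !ltW.
apply: (chord_glue u01 erefl) => // [t' t'01|t' t'01|].
- by apply: IH => //; apply: leq_trans xz leN.
- by apply: IH => //; apply: leq_trans zy leN.
- exact: second_diff_small.
Qed.

Let bent_convex x y t : 0 <= t <= 1 ->
  C * bent (comb x y t) <= (1 - t) * (C * bent x) + t * (C * bent y).
Proof.
move=> t01; have := ler_wpM2l C_ge0 (bent_comb x y t01).
have : 0 <= C * (t * (1 - t) * dotp (y - x) (y - x)).
  by case/andP: t01 => t0 t1; rewrite !mulr_ge0 ?C_ge0 ?subr_ge0 ?dotp_self_ge0.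
by move: C => C'; lra.
Qed.

Lemma piecewise_quadratic_dc : exists h : 'cV[R]_n -> R,
  (forall x y t, S x -> S y -> 0 <= t <= 1 ->
     h ((1 - t) *: x + t *: y) <= (1 - t) * h x + t * h y) /\
  (forall x y t, S x -> S y -> 0 <= t <= 1 ->
     f ((1 - t) *: x + t *: y) + h ((1 - t) *: x + t *: y) <=
     (1 - t) * (f x + h x) + t * (f y + h y)).
Proof.
exists (fun x => C * bent x); split=> x y t Sx Sy t01; first exact: bent_convex.
exact: piecewise_quadratic_convex.
Qed.

End PiecewiseQuadratic.

(** * Extreme points of the multiplier polyhedra *)

Section ExtremePoints.
Variables (R : realType) (m k : nat) (D : 'M[R]_(k, m)).

Let mult c : set 'cV[R]_k := [set mu | lev 0 mu /\ D^T *m mu = c].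

Let support (x : 'cV[R]_k) : {set 'I_k} := [set i | x i 0 != 0]%SET.

Let two_sided_step (x w : 'cV[R]_k) : lev 0 x -> support w \subset support x ->
  exists2 t : R, 0 < t & lev 0 (x + t *: w) /\ lev 0 (x - t *: w).
Proof.
move=> /lev0P x0 sub.
have [e0 e0p he0] := small_step x w; have [e1 e1p he1] := small_step x (- w).
have tp : 0 < Num.min e0 e1 by rewrite lt_min e0p.
exists (Num.min e0 e1) => //.
have out i : x i 0 = 0 -> w i 0 = 0.
  move=> xi; apply: contraTeq sub => wi; apply/subsetPn.
  by exists i; rewrite !inE ?xi ?eqxx.
have h (w' : 'cV[R]_k) : (forall i, x i 0 = 0 -> w' i 0 = 0) ->
    (forall i, 0 <= x i 0 * (x i 0 + Num.min e0 e1 * w' i 0)) ->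
    lev 0 (x + Num.min e0 e1 *: w').
  move=> out' hx; apply/lev0P => i; rewrite !mxE.
  have [xi|xi] := eqVneq (x i 0) 0; first by rewrite xi out' // mulr0 addr0.
  by have := hx i; rewrite pmulr_rge0 // lt_neqAle eq_sym xi x0.
split; first by apply: h => // i; apply: he0; rewrite ltW // ge_min lexx.
rewrite -scalerN; apply: h => i; first by move/out => wi; rewrite mxE wi oppr0.
by apply: he1; rewrite ltW // ge_min lexx orbT.
Qed.

(** With equal supports, [y - x] is a null direction of [D^T] along which [x] can move both ways,
    which extremality allows only for the zero direction. Hence extreme points are determined by
    finitely many supports. *)
Lemma extreme_point_support c x y :
  extreme_points (mult c) x -> extreme_points (mult c) y ->
  (forall i, (x i 0 != 0) = (y i 0 != 0)) -> x = y.
Proof.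
move=> [[x0 Dx] ext] [[y0 Dy] _] sxy.
have [|t t0 [tp tn]] := @two_sided_step x (y - x) x0.
  apply/fintype.subsetP => i; rewrite !inE; apply: contraNneq => xi.
  by rewrite !mxE xi subr0 -[_ == 0]negbK -sxy xi eqxx.
have Dxy : D^T *m (y - x) = 0 by rewrite mulmxBr Dx Dy subrr.
have [] := ext (x + t *: (y - x)) (x - t *: (y - x)) 2^-1.
- by split=> //; rewrite mulmxDr -scalemxAr Dxy scaler0 addr0.
- by split=> //; rewrite mulmxBr -scalemxAr Dxy scaler0 subr0.
- by lra.
- by apply/colP => i; rewrite !mxE; field.
move=> + _; rewrite -[RHS]addr0 => /addrI /eqP; rewrite scaler_eq0 gt_eqF //=.
by rewrite subr_eq0 => /eqP.
Qed.

(** While [mu] is not extreme, some null direction of [D^T] lives on its support. Moving along it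
    with [dotp b] nondecreasing until a coordinate vanishes shrinks the support, so the process
    ends. *)
Lemma extreme_point_exists b c mu : (exists z, lev b (D *m z)) -> mult c mu ->
  exists mu', extreme_points (mult c) mu' /\ dotp b mu <= dotp b mu'.
Proof.
move=> [z0 hz0]; have [N] := ubnP #|support mu|; elim: N mu => // N IH mu.
rewrite ltnS => leN [mu0 Dmu].
have [|next] := pselect (extreme_points (mult c) mu); first by exists mu.
(* If [mu] lies strictly between [y] and [z], a zero coordinate of [mu] is zero in [y]; so [y - mu]
   serves as [w] unless it vanishes. *)
have [w [w0 Dw sw]] : exists w, [/\ w != 0, D^T *m w = 0 & support w \subset support mu].
  apply: contrapT => noW; apply: next; split=> // y z t [y0 Dy] [z_0 Dz] /andP[t0 t1] E.
  have ymu : y = mu.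
    apply: contrapT => ymu; apply: noW; exists (y - mu); split.
    - by rewrite subr_eq0; apply/eqP.
    - by rewrite mulmxBr Dy Dmu subrr.
    apply/fintype.subsetP => i; rewrite !inE; apply: contraNneq => mui.
    move: (congr1 (fun x : 'cV[R]_k => x i 0) E); rewrite /= mui !mxE => /esym/eqP.
    have := proj1 (lev0P _) y0 i; have := proj1 (lev0P _) z_0 i => zi yi.
    rewrite paddr_eq0 ?mulr_ge0 ?subr_ge0 ?(ltW t0) ?(ltW t1) //.
    by rewrite !mulf_eq0 gt_eqF //= => /andP[/eqP -> _]; rewrite mui subr0.
  split=> //; move: E; rewrite ymu => /(congr1 (fun x => x - t *: mu)).
  rewrite addrAC subrr add0r -{1}(scale1r mu) -scalerBl => /eqP.
  rewrite eq_sym -subr_eq0 -scalerBr scaler_eq0 subr_eq0 gt_eqF //=.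
  by rewrite subr_eq0 => /eqP.
(* Primal feasibility of [z0] bounds [dotp b] on the recession cone of the multipliers. *)
have bw u : lev 0 u -> D^T *m u = 0 -> dotp b u <= 0.
  move=> u0 Du; have : 0 <= dotp (D *m z0 - b) u.
    by apply: dotp_ge0 => //; exact: (proj1 (lev_sub _ _) hz0).
  by rewrite dotpDl dotpNl dotpC dotp_mulmx Du dotpC dotp0r sub0r oppr_ge0.
(* One of [w] and [- w] does not decrease [dotp b] and also leaves the orthant; by [bw] these two
   demands are compatible. *)
have [w' [i0 [wi0 Dw' sw' bw']]] : exists (w' : 'cV[R]_k) (i0 : 'I_k),
    [/\ w' i0 0 < 0, D^T *m w' = 0, support w' \subset support mu & 0 <= dotp b w'].
  have neg (u : 'cV[R]_k) : u != 0 -> lev 0 u -> exists i, (- u) i 0 < 0.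
    move=> u0 /lev0P up; apply: contrapT => h; move/eqP: u0; apply.
    apply/colP => i; rewrite [RHS]mxE; apply/eqP; rewrite eq_le up andbT leNgt.
    by apply/negP => ui; apply: h; exists i; rewrite mxE oppr_lt0.
  have neg2 (u : 'cV[R]_k) : ~ lev 0 u -> exists i, u i 0 < 0.
    move=> h; apply: contrapT => h'; apply: h; apply/lev0P => i.
    by rewrite leNgt; apply/negP => ui; apply: h'; exists i.
  have DN : D^T *m - w = 0 by rewrite mulmxN Dw oppr0.
  have sN : support (- w) \subset support mu.
    by apply: fintype.subset_trans _ sw; apply/fintype.subsetP => i; rewrite !inE mxE oppr_eq0.
  have [wp|/neg2 [i wi]] := pselect (lev 0 w).
    have [i wi] := neg _ w0 wp; exists (- w), i; split=> //.
    by rewrite dotpNr oppr_ge0; exact: bw.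
  have [bw0|bw0] := lerP 0 (dotp b w); first by exists w, i.
  have [wn|/neg2 [j wj]] := pselect (lev 0 (- w)).
    by have := bw _ wn DN; rewrite dotpNr; lra.
  by exists (- w), j; split=> //; rewrite dotpNr; lra.
(* Ratio test: [i] is a coordinate that reaches zero first. *)
case: (Order.TotalTheory.arg_minP (P := fun i => w' i 0 < 0)
  (fun i => mu i 0 / - w' i 0) wi0) => i wi imin.
set t := mu i 0 / - w' i 0 in imin.
have mup := proj1 (lev0P _) mu0.
have t0 : 0 <= t by rewrite divr_ge0 ?oppr_ge0 ?(ltW wi).
have mu't : mult c (mu + t *: w').
  split; last by rewrite mulmxDr -scalemxAr Dw' scaler0 addr0.
  apply/lev0P => j; rewrite !mxE; have [wj|wj] := lerP 0 (w' j 0).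
    by apply: addr_ge0 (mup j) (mulr_ge0 t0 wj).
  by have := imin _ wj; rewrite ler_pdivlMr ?oppr_gt0 //; lra.
have [|mu' [ext le]] := IH _ _ mu't; last first.
  exists mu'; split=> //; apply: le_trans le.
  by rewrite dotpDr dotpZr lerDl mulr_ge0.
apply: leq_trans leN; apply/proper_card/properP; split.
  apply/fintype.subsetP => j; rewrite !inE !mxE; apply: contraNneq => muj.
  suff -> : w' j 0 = 0 by rewrite muj mulr0 addr0.
  by apply: contraTeq sw' => wj; apply/subsetPn; exists j; rewrite !inE ?muj ?eqxx.
exists i; rewrite !inE; last first.
  by rewrite !mxE /t invrN mulrN mulNr mulrVK ?subrr ?eqxx // unitfE lt_eqF.
have : i \in support mu by apply: (fintype.subsetP sw'); rewrite inE lt_eqF.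
by rewrite inE.
Qed.

End ExtremePoints.

(** * Selection of rows *)

Section RowSelection.
Variables (R : realType) (k : nat).

Lemma rows_mulmx (I : {set 'I_k}) n (A : 'M[R]_(k, n)) p (B : 'M[R]_(n, p)) :
  rows I A *m B = rows I (A *m B).
Proof. by apply/matrixP => i j; rewrite !mxE; apply: eq_bigr => l _; rewrite mxE. Qed.

Lemma rows_eqP (I : {set 'I_k}) (x y : 'cV[R]_k) :
  rows I x = rows I y <-> forall i, i \in I -> x i 0 = y i 0.
Proof.
split=> [h i iI|h].
  move: (congr1 (fun z : 'cV[R]_#|I| => z (enum_rank_in iI i) 0) h).
  by rewrite !mxE enum_rankK_in.
by apply/colP => i; rewrite !mxE h // enum_valP.
Qed.

Lemma rows_leP (I : {set 'I_k}) (x y : 'cV[R]_k) :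
  lev (rows I x) (rows I y) <-> forall i, i \in I -> x i 0 <= y i 0.
Proof.
split=> [h i iI|h i]; last by rewrite !mxE h // enum_valP.
by have := h (enum_rank_in iI i); rewrite !mxE enum_rankK_in.
Qed.

Lemma rows0 (I : {set 'I_k}) n : rows I 0 = 0 :> 'M[R]_(_, n).
Proof. by apply/matrixP => i j; rewrite !mxE. Qed.

End RowSelection.

(** * Existence of minimizers and KKT points *)

Section KKT.
Variables (R : realType) (m k : nat) (Q : 'M[R]_m) (D : 'M[R]_(k, m)).
Hypothesis Qsym : Q^T = Q.

Lemma qp_obj_line q z v t :
  qp_obj Q q (z + t *: v) =
  qp_obj Q q z + t * dotp (q + Q *m z) v + t ^+ 2 / 2 * quadform Q v.
Proof.
rewrite /qp_obj !quadform_dotp mulmxDr -scalemxAr !dotp_linE.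
rewrite [dotp z (Q *m v)]dotp_mulmx Qsym [dotp v (Q *m z)]dotpC.
by field.
Qed.

(** Fredholm alternative for the stationarity system on the kernel of [B]. If it is unsolvable, a
    vector of the left kernel detects this; its first block, with a suitable sign, is a descent
    direction without curvature. *)
Lemma saddle_solvable p (B : 'M[R]_(p, m)) g :
  (exists d eta, B *m d = 0 /\ g + Q *m d = B^T *m eta) \/
  (exists u, [/\ B *m u = 0, forall v, B *m v = 0 -> dotp (Q *m u) v = 0
     & dotp g u < 0]).
Proof.
pose M := block_mx Q (- B^T) B (0 : 'M[R]_p).
pose r := col_mx (- g) (0 : 'cV[R]_p).
have [/submxP [X hX]|nsub] := boolP (r^T <= M^T)%MS.
  left; move/(congr1 trmx): hX; rewrite trmx_mul !trmxK -(vsubmxK X^T) mul_block_col mul0mx addr0.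
  move=> /eq_col_mx [h1 h2]; exists (usubmx X^T), (dsubmx X^T); split=> //.
  by rewrite -[g]opprK h1 mulNmx opprD opprK addrAC addNr add0r.
right.
have [j hj] : exists j, (r^T *m cokermx M^T) 0 j != 0.
  apply: contrapT => h; move/negP: nsub; apply; rewrite submxE; apply/eqP/rowP => j.
  by rewrite [RHS]mxE; apply: contrapT => hj; apply: h; exists j; apply/eqP.
(* The column of the cokernel that is not orthogonal to the right-hand side. *)
pose y := cokermx M^T *m delta_mx j (0 : 'I_1).
have My : M^T *m y = 0 by rewrite mulmxA mulmx_coker mul0mx.
have ry : dotp r y != 0 by rewrite /dotp mulmxA -colE mxE.
pose u := usubmx y; pose w := dsubmx y.
have [Qu Bu] : Q *m u = - (B^T *m w) /\ B *m u = 0.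
  move: My; rewrite tr_block_mx Qsym linearN /= trmxK trmx0 -(vsubmxK y) mul_block_col.
  rewrite -col_mx0 mul0mx addr0 mulNmx => /eq_col_mx [h1 h2].
  by split; [apply/eqP; rewrite -addr_eq0 h1 | apply/eqP; rewrite -oppr_eq0 h2].
have gu : dotp g u != 0.
  by move: ry; rewrite /r -(vsubmxK y) dotp_col_mx dotpNl (dotpC 0) dotp0r addr0 oppr_eq0.
have Qu0 v : B *m v = 0 -> dotp (Q *m u) v = 0.
  by move=> Bv; rewrite Qu dotpNl -dotp_mulmx Bv dotp0r oppr0.
case: (ltrgtP (dotp g u) 0) gu => // gu _; first by exists u.
exists (- u); split; first by rewrite mulmxN Bu oppr0.
  by move=> v /Qu0; rewrite mulmxN dotpNl => ->; rewrite oppr0.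
by rewrite dotpNr oppr_lt0.
Qed.

Variables (q : 'cV[R]_m) (b : 'cV[R]_k).

Let feasible z := lev b (D *m z).
Let f z := qp_obj Q q z.
Let active (z : 'cV[R]_m) : {set 'I_k} := [set i | (D *m z) i 0 == b i 0]%SET.

(** Criticality on the affine hull of the active face: the multipliers carry no sign yet. *)
Let stationary z := forall v, rows (active z) D *m v = 0 -> dotp (q + Q *m z) v = 0.

Let activeP (I : {set 'I_k}) (v : 'cV[R]_m) :
  rows I D *m v = 0 <-> forall i, i \in I -> (D *m v) i 0 = 0.
Proof.
rewrite rows_mulmx -(rows0 _ I) rows_eqP.
by split=> h i /h; rewrite ?mxE // => ->; rewrite mxE.
Qed.

Let D_line (z v : 'cV[R]_m) t i :
  (D *m (z + t *: v)) i 0 = (D *m z) i 0 + t * (D *m v) i 0.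
Proof. by rewrite mulmxDr -scalemxAr mxE [X in _ + X]mxE. Qed.

(** Along a direction tangent to the active constraints these stay active. If the full step is
    infeasible, stopping at the first constraint to be violated adds it to the active set. *)
Let first_exit (z v : 'cV[R]_m) T : feasible z -> rows (active z) D *m v = 0 -> 0 <= T ->
  (feasible (z + T *: v) /\ active z \subset active (z + T *: v)) \/
  (exists2 t, 0 <= t <= T & feasible (z + t *: v) /\
     active z \proper active (z + t *: v)).
Proof.
move=> hz /activeP hv T0.
have sub t : active z \subset active (z + t *: v).
  apply/fintype.subsetP => i iz; rewrite inE D_line hv // mulr0 addr0.
  by move: iz; rewrite inE.
have [hT|hT] := pselect (feasible (z + T *: v)); [by left|right].
have [i0 hi0] : exists i, (D *m (z + T *: v)) i 0 < b i 0.
  by apply: contrapT => h; apply: hT => i; rewrite leNgt; apply/negP => hi; apply: h; exists i.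
case: (Order.TotalTheory.arg_minP (P := fun i => (D *m (z + T *: v)) i 0 < b i 0)
  (fun i => ((D *m z) i 0 - b i 0) / - (D *m v) i 0) hi0) => i hi imin.
have neg j : (D *m (z + T *: v)) j 0 < b j 0 -> (D *m v) j 0 < 0.
  move=> hj; rewrite ltNge; apply/negP => vj; move: hj; rewrite D_line ltNge.
  by rewrite (le_trans (hz j)) // lerDl mulr_ge0.
set t := _ / _ in imin; have vi := neg _ hi.
have t0 : 0 <= t by rewrite divr_ge0 ?oppr_ge0 ?subr_ge0 ?(ltW vi) // hz.
have tE : t * (D *m v) i 0 = b i 0 - (D *m z) i 0.
  by rewrite /t invrN mulrN mulNr mulrVK ?opprB // unitfE lt_eqF.
have tT : t <= T.
  by rewrite ler_pdivrMr ?oppr_gt0 //; move: hi; rewrite D_line; lra.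
exists t; first by rewrite t0.
split=> [j|].
  rewrite D_line; have [hj|hj] := ltrP ((D *m (z + T *: v)) j 0) (b j 0).
    by have := imin _ hj; have := neg _ hj => vj; rewrite ler_pdivlMr ?oppr_gt0 //; lra.
  have := hz j; move: hj; rewrite D_line; have [vj|vj] := lerP 0 ((D *m v) j 0).
    by have := mulr_ge0 t0 vj; lra.
  by have : T * (D *m v) j 0 <= t * (D *m v) j 0; [rewrite ler_wnM2r // ltW|lra].
apply/properP; split=> //; exists i; rewrite inE ?D_line ?tE ?subrKC //.
apply: contraTneq vi => zi; rewrite hv ?ltxx // inE zi //.
Qed.
Variable gamma : R.
Hypothesis f_bounded : forall z, feasible z -> gamma <= f z.

(* Along [v] the objective would be unbounded below, so the ray leaves the
   feasible set, at a point where more constraints are active. *)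
Let descend z v : feasible z -> rows (active z) D *m v = 0 ->
  dotp (q + Q *m z) v < 0 -> quadform Q v <= 0 ->
  exists z', [/\ feasible z', active z \proper active z' & f z' <= f z].
Proof.
move=> hz hv gv qv; set s := dotp _ _ in gv.
(* At this length the linear part alone brings the objective to [gamma - 1]. *)
pose T := (f z - gamma + 1) / - s.
have T0 : 0 <= T.
  by rewrite divr_ge0 ?oppr_ge0 ?(ltW gv) // addr_ge0 ?subr_ge0 ?f_bounded.
have TE : T * s = - (f z - gamma + 1).
  by rewrite /T invrN mulrN mulNr mulrVK // unitfE lt_eqF.
have le t : f (z + t *: v) <= f z + t * s.
  rewrite /f qp_obj_line -/s gerDl; have := sqr_ge0 t; nra.
case: (first_exit hz hv T0) => [[hT _]|[t /andP[t0 _] [ht act]]].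
  by have := f_bounded hT; have := le T; rewrite TE; lra.
by exists (z + t *: v); split=> //; apply: le_trans (le t) _; nra.
Qed.

(** Induction on the number of inactive constraints. Either [descend] applies to a curvature-free
    direction, or [d] is a Newton step on the active face. With negative curvature [- d] is a
    descent direction; otherwise moving towards [z + d] does not increase the objective and ends at
    a stationary point or a new constraint. *)
Let reach_stationary z : feasible z ->
  exists z', [/\ feasible z', f z' <= f z & stationary z'].
Proof.
have [N] := ubnP (k - #|active z|); elim: N z => // N IH z.
rewrite ltnS => leN hz.
have step z' : feasible z' -> active z \proper active z' -> f z' <= f z ->
    exists w, [/\ feasible w, f w <= f z & stationary w].
  move=> hz' /proper_card lt le; have [|w [hw le' st]] := IH _ _ hz'.
    apply: leq_trans leN; rewrite ltn_sub2l //.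
    by apply: leq_trans lt _; rewrite -[k in leqRHS]card_ord max_card.
  by exists w; split=> //; exact: le_trans le.
have [[d [eta [Bd gd]]]|[u [Bu Qu gu]]] :=
    saddle_solvable (rows (active z) D) (q + Q *m z);
  last first.
  have [|z' []] := descend hz Bu gu; last exact: step.
  by rewrite quadform_dotp dotpC Qu.
have gv v : rows (active z) D *m v = 0 ->
    dotp (q + Q *m z) v = - dotp (Q *m d) v.
  move=> Bv; apply/eqP; rewrite -addr_eq0 -dotpDl gd -dotp_mulmx Bv.
  by rewrite dotp0r.
have gE : dotp (q + Q *m z) d = - quadform Q d.
  by rewrite gv // quadform_dotp dotpC.
have [qd|qd] := lerP 0 (quadform Q d); last first.
  have [|||z' []] := @descend z (- d) hz; last exact: step.
  - by rewrite mulmxN Bd oppr0.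
  - by rewrite dotpNr gE opprK.
  by rewrite quadform_dotp mulmxN dotpNl dotpNr opprK -quadform_dotp ltW.
have le t : 0 <= t <= 1 -> f (z + t *: d) <= f z.
  move=> /andP[t0 t1]; rewrite /f qp_obj_line gE -addrA gerDl.
  have t2 : 0 <= 1 - t / 2 by lra.
  by have := mulr_ge0 (mulr_ge0 t0 t2) qd; lra.
case: (first_exit hz Bd ler01) => [[h1 act]|[t t01 [ht act]]]; last first.
  by apply: (step _ ht act); exact: le.
exists (z + 1 *: d); split=> //; first by apply: le; rewrite ler01 lexx.
move=> v /activeP hv; have Bv : rows (active z) D *m v = 0.
  by apply/activeP => i /(fintype.subsetP act); exact: hv.
by rewrite scale1r mulmxDr addrA dotpDl gv // addNr.
Qed.

(** [z' - z] is tangent to the common face, and both gradients vanish along it, so slope and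
    curvature in that direction are zero. *)
Let stationary_eq z z' : stationary z -> stationary z' ->
  active z = active z' -> f z = f z'.
Proof.
move=> sz sz' act.
have Bv : rows (active z) D *m (z' - z) = 0.
  apply/activeP => i iz; rewrite mulmxBr mxE [X in _ + X]mxE.
  move: (iz); rewrite {1}act !inE => /eqP ->; move: iz; rewrite inE => /eqP ->.
  by rewrite subrr.
have Bv' : rows (active z') D *m (z' - z) = 0 by rewrite -act.
have g1 := sz _ Bv; have := sz' _ Bv'.
rewrite -{1}(subrKC z z') mulmxDr addrA dotpDl g1 add0r => g2.
rewrite -[in RHS](subrKC z z') -[z' - z]scale1r /f qp_obj_line g1 quadform_dotp.
by rewrite dotpC g2 !mulr0 !addr0.
Qed.

(* Frank and Wolfe: since the objective takes only one value on the
   stationary points with given active constraints, it takes finitely many. *)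
Lemma qp_min_exists : (exists z, feasible z) ->
  exists z, feasible z /\ forall z', feasible z' -> f z <= f z'.
Proof.
move=> [z0 /reach_stationary [z1 [hz1 _ sz1]]].
pose good I := `[< exists z, [/\ feasible z, stationary z & active z = I] >].
have [rep hrep] : exists rep : {set 'I_k} -> 'cV[R]_m, forall I, good I ->
    [/\ feasible (rep I), stationary (rep I) & active (rep I) = I].
  have h I : exists z, good I -> [/\ feasible z, stationary z & active z = I].
    by have [/asboolP [z hz]|] := boolP (good I); [exists z | exists 0].
  by have [rep hrep] := choice h; exists rep.
have good1 : good (active z1) by apply/asboolP; exists z1.
case: (Order.TotalTheory.arg_minP (P := good) (fun I => f (rep I)) good1) => I gI Imin.
have [hI sI _] := hrep _ gI.
exists (rep I); split=> // z /reach_stationary [z' [hz' le sz']].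
have gz' : good (active z') by apply/asboolP; exists z'.
have [hr sr ar] := hrep _ gz'.
by apply: le_trans (Imin _ gz') _; rewrite (stationary_eq sr sz' ar).
Qed.

(** By [farkas], signed multipliers exist unless some direction [d] keeps the active constraints and
    has negative slope; a short step along it would then improve on the minimizer. *)
Lemma qp_min_QD z : feasible z -> (forall z', feasible z' -> f z <= f z') ->
  QD Q D (active z) (q, b).
Proof.
move=> hz zmin.
have [eta [eta0 hE]] : exists eta, lev 0 eta /\
    (rows (active z) D)^T *m eta = q + Q *m z.
  apply: farkas => d; rewrite rows_mulmx -(rows0 _ (active z)) => /rows_leP hd.
  rewrite leNgt; apply/negP; set s := dotp _ _ => s0.
  have [e0 e0p he0] := small_step (D *m z - b) (D *m d).
  (* The first bound preserves the inactive constraints, the second makes the slope outweigh the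
     curvature. *)
  pose t := Num.min e0 (- s / (`|quadform Q d| + 1)).
  have c0 : 0 < `|quadform Q d| + 1 by rewrite ltr_wpDl.
  have tp : 0 < t by rewrite lt_min e0p divr_gt0 // oppr_gt0.
  have t0 : 0 <= t <= e0 by rewrite ltW // ge_min lexx.
  have ht : feasible (z + t *: d).
    move=> i; have := he0 _ t0 i; have := hz i; rewrite D_line.
    have -> : (D *m z - b) i 0 = (D *m z) i 0 - b i 0 by rewrite mxE [X in _ + X]mxE.
    have [zi|zi] := eqVneq ((D *m z) i 0) (b i 0) => hzi.
      rewrite zi => _; rewrite lerDl mulr_ge0 ?(ltW tp) //.
      by have := hd i; rewrite mxE; apply; rewrite inE zi.
    by rewrite pmulr_rge0; [lra | rewrite subr_gt0 lt_neqAle eq_sym zi].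
  have := zmin _ ht; rewrite /f qp_obj_line -/s -addrA lerDl leNgt => /negP; apply.
  have h1 : t * (`|quadform Q d| + 1) <= - s.
    by rewrite -ler_pdivlMr // ge_min lexx orbT.
  have h2 : t * quadform Q d <= t * `|quadform Q d|.
    by rewrite ler_wpM2l ?(ltW tp) // ler_norm.
  have h3 : s + t / 2 * quadform Q d < 0 by lra.
  by rewrite (_ : _ + _ = t * (s + t / 2 * quadform Q d)); [rewrite pmulr_rlt0 | ring].
exists z, eta; split.
- by rewrite /= -hE subrr.
- by rewrite rows_mulmx; apply/rows_eqP => i; rewrite inE => /eqP.
- exact: eta0.
- by rewrite rows_mulmx; apply/rows_leP => i _; exact: hz.
Qed.

End KKT.

(** * Transfer from column vectors to pairs *)

Section DifferenceOfConvex.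
Variables (R : realType) (m k : nat).
Let V := ('cV[R]_m * 'cV[R]_k)%type.

Let pair_of (x : 'cV[R]_(m + k)) : V := (usubmx x, dsubmx x).

Let pair_ofK (p : V) : pair_of (col_mx p.1 p.2) = p.
Proof. by rewrite /pair_of col_mxKu col_mxKd; case: p. Qed.

Let mx_ofK x : col_mx (pair_of x).1 (pair_of x).2 = x.
Proof. exact: vsubmxK. Qed.

(** The inequalities of all pieces are stacked into one matrix, its rows indexed by a piece and one
    of its rows, to fit [piecewise_quadratic_dc]. Replacing [f] by [fine] of it loses nothing on a
    piece, where [f] is finite. *)
Lemma dc_of_polyhedral_pieces (T : finType) (P : T -> set V) (S : set V) f :
  convex_set S ->
  (forall i, polyhedral_cone [set x | P i (pair_of x)]) ->
  (forall i, quadratic_on (P i) f) ->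
  (forall p, S p -> exists i, P i p) ->
  dc_on S f.
Proof.
move=> Sconv Ppoly Pquad Scov; split=> //.
have [r hr] := choice Ppoly.
have [M hM] : exists M : forall i, 'M[R]_(r i, m + k),
    forall i x, P i (pair_of x) <-> lev 0 (M i *m x).
  by exists (fun i => projT1 (cid (hr i))) => i x; case: (cid (hr i)) => M hM; exact: hM.
have [Th hTh] := choice Pquad; have [c hc] := choice hTh; have [e he] := choice hc.
pose I := {i : T & 'I_(r i)}.
pose A : 'M[R]_(#|{: I}|, m + k) :=
  \matrix_(l < #|{: I}|) row (tagged (enum_val l)) (M (tag (enum_val l))).
pose K i : {set 'I_#|{: I}|} := [set l | tag (enum_val l) == i]%SET.
have AE l (x : 'cV[R]_(m + k)) :
    (A *m x) l 0 = (M (tag (enum_val l)) *m x) (tagged (enum_val l)) 0.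
  by rewrite mulmx_row rowK -mulmx_row.
have pieceE i x : piece A K i x <-> P i (pair_of x).
  rewrite hM; split=> [h|/lev0P h l]; last first.
    rewrite inE AE; case: (enum_val l) => j a /= /eqP ij.
    by case: _ / ij h a => h a; exact: h.
  apply/lev0P => a; have := h (enum_rank (Tagged (fun i => 'I_(r i)) a)).
  by rewrite inE AE enum_rankK eqxx; apply.
have fE i x : piece A K i x ->
    fine (f (pair_of x)) = quadform (Th i) x + dotp (c i) x + e i.
  by move=> /pieceE /he ->; rewrite mx_ofK.
have pair_comb t x y :
    pair_of ((1 - t) *: x + t *: y) = (1 - t) *: pair_of x + t *: pair_of y.
  by rewrite /pair_of !linearD !linearZ.
pose S' : set 'cV[R]_(m + k) := [set x | S (pair_of x)].
have S'conv x y t : S' x -> S' y -> 0 <= t <= 1 -> S' ((1 - t) *: x + t *: y).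
  move=> Sx Sy /andP[t0 t1]; rewrite /S' /= pair_comb addrC.
  by have := Sconv _ _ (Itv01 t0 t1) (mem_set Sy) (mem_set Sx); rewrite inE.
have S'cov x : S' x -> exists i, piece A K i x.
  by move=> /Scov [i /pieceE hi]; exists i.
have [h [hconv fhconv]] := piecewise_quadratic_dc fE S'conv S'cov.
pose col (p : V) := col_mx p.1 p.2.
have t01 (t : {i01 R}) : 0 <= t%:num <= 1 by rewrite ge0 le1.
(* [conv t p p'] gives weight [t] to its first point, while [piecewise_quadratic_dc] gives it to the
   second; hence the swap. *)
have colE (t : {i01 R}) (p p' : convex_lmodType V) :
    col (conv t p p') = (1 - t%:num) *: col p' + t%:num *: col p.
  rewrite /col !scale_col_mx add_col_mx addrC.
  by congr col_mx; rewrite addrC.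
have S'col (p : convex_lmodType V) : p \in S -> S' (col p).
  by rewrite inE /S' /= /col pair_ofK.
exists (fun p => fine (f p) + h (col p)), (fun p => h (col p)); split.
- move=> t p p' /S'col Sp /S'col Sp'.
  have := fhconv _ _ _ Sp' Sp (t01 t); rewrite -colE !pair_ofK => /le_trans; apply.
  by rewrite convRE addrC.
- move=> t p p' /S'col Sp /S'col Sp'.
  have := hconv _ _ _ Sp' Sp (t01 t); rewrite -colE => /le_trans; apply.
  by rewrite convRE addrC.
move=> p Sp; have [i hi] := Scov _ Sp.
by rewrite addrK (he _ _ hi).
Qed.

End DifferenceOfConvex.

(** * The domain of the value function and its finite cover *)

Section ValueFunction.
Variables (R : realType) (m k : nat) (Q : 'M[R]_m) (D : 'M[R]_(k, m)).
Hypothesis Qsym : Q^T = Q.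
Implicit Types p : 'cV[R]_m * 'cV[R]_k.

Lemma qp_domP p : qp_dom Q D p <->
  (exists z, lev p.2 (D *m z)) /\
  (exists gamma, forall z, lev p.2 (D *m z) -> gamma <= qp_obj Q p.1 z).
Proof.
split=> [[lo hi]|[[z hz] [gamma h]]].
  split.
    apply: contrapT => h; move: hi; rewrite /qp_opt.
    rewrite [X in ereal_inf X](_ : _ = set0) ?ereal_inf0 ?ltxx //.
    by rewrite -subset0 => y [z hz _]; apply: h; exists z.
  have fin : qp_opt Q D p \is a fin_num by rewrite fin_real // lo.
  exists (fine (qp_opt Q D p)) => z hz; rewrite -lee_fin fineK //.
  by apply: ereal_inf_lbound; exists z.
split.
  apply: (@lt_le_trans _ _ gamma%:E); first exact: ltNyr.
  by apply/ereal_infP => _ [z' hz' <-]; rewrite lee_fin h.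
apply: (@le_lt_trans _ _ (qp_obj Q p.1 z)%:E); last exact: ltry.
by apply: ereal_inf_lbound; exists z.
Qed.

Lemma qp_opt_min p z : lev p.2 (D *m z) ->
  (forall z', lev p.2 (D *m z') -> qp_obj Q p.1 z <= qp_obj Q p.1 z') ->
  qp_opt Q D p = (qp_obj Q p.1 z)%:E.
Proof.
move=> hz zmin; apply/eqP; rewrite eq_le; apply/andP; split.
  by apply: ereal_inf_lbound; exists z.
by apply/ereal_infP => _ [z' hz' <-]; rewrite lee_fin zmin.
Qed.

Lemma qp_dom_QD p : qp_dom Q D p -> exists I, QD Q D I p.
Proof.
case: p => q b /qp_domP /= [ne [gamma h]].
have [z [hz zmin]] := qp_min_exists Qsym h ne.
by eexists; apply: qp_min_QD hz zmin.
Qed.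

Lemma QD_feasible I p : QD Q D I p -> exists z, lev p.2 (D *m z).
Proof.
move=> [z [eta [_ hI _ hJ]]]; exists z => i.
have [iI|iI] := boolP (i \in I).
  by move: hI; rewrite rows_mulmx => /rows_eqP -> .
by move: hJ; rewrite rows_mulmx => /rows_leP; apply; rewrite inE.
Qed.

Lemma QD_polyhedral I :
  polyhedral_cone [set x | QD Q D I (usubmx x, dsubmx x)].
Proof.
(* The four defining conditions are linear in [((q, b), (z, eta))]; projecting out [(z, eta)] yields
   the cone. *)
pose M1 : 'M[R]_(m, (m + k) + (m + #|I|)) :=
  row_mx (row_mx 1%:M 0) (row_mx Q (- (rows I D)^T)).
pose M2 : 'M[R]_(#|I|, (m + k) + (m + #|I|)) :=
  row_mx (row_mx 0 (- rows I 1%:M)) (row_mx (rows I D) 0).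
pose M3 : 'M[R]_(#|I|, (m + k) + (m + #|I|)) := row_mx 0 (row_mx 0 1%:M).
pose M4 : 'M[R]_(#|(~: I)%SET|, (m + k) + (m + #|I|)) :=
  row_mx (row_mx 0 (- rows (~: I)%SET 1%:M)) (row_mx (rows (~: I)%SET D) 0).
have [r [N hN]] := polyhedral_cone_proj (polyhedral_coneI
  (polyhedral_coneI (polyhedral_cone_eq0 M1) (polyhedral_cone_eq0 M2))
  (polyhedral_coneI (polyhedral_cone_ge0 M3) (polyhedral_cone_ge0 M4))).
exists r, N => x; rewrite -hN -(vsubmxK x).
move: (usubmx x) (dsubmx x) => q b; rewrite /QD /= col_mxKu col_mxKd.
have E1 z eta : M1 *m col_mx (col_mx q b) (col_mx z eta) =
    q + Q *m z - (rows I D)^T *m eta.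
  by rewrite !mul_row_col mul1mx mul0mx addr0 mulNmx addrA.
have E2 z eta : M2 *m col_mx (col_mx q b) (col_mx z eta) =
    rows I D *m z - rows I b.
  by rewrite !mul_row_col !mul0mx add0r addr0 mulNmx (rows_mulmx I 1%:M) mul1mx addrC.
have E3 z eta : M3 *m col_mx (col_mx q b) (col_mx z eta) = eta.
  by rewrite !mul_row_col !mul0mx !add0r mul1mx.
have E4 z eta : M4 *m col_mx (col_mx q b) (col_mx z eta) =
    rows (~: I)%SET D *m z - rows (~: I)%SET b.
  rewrite !mul_row_col !mul0mx add0r addr0 mulNmx.
  by rewrite (rows_mulmx (~: I)%SET 1%:M) mul1mx addrC.
split=> [[z [eta [h1 h2 h3 h4]]]|[y]].
  exists (col_mx z eta); rewrite E1 E2 E3 E4 h1 h2 subrr.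
  by split=> //; split=> //; apply: (proj1 (lev_sub _ _)).
rewrite -(vsubmxK y) E1 E2 E3 E4 => -[[h1 h2] [h3 h4]].
exists (usubmx y), (dsubmx y); split=> //; first exact: subr0_eq.
exact: (proj2 (lev_sub _ _)).
Qed.

Lemma critical_generator L (gen : forall I, 'I_(L I) -> 'cV[R]_m * 'cV[R]_k) I l :
  is_generators Q D gen -> critical_cone Q D I (gen I l).
Proof.
move=> <-; exists (fun j => (j == l)%:R); split=> [j|]; first by case: (j == l).
rewrite (bigD1 l) //= eqxx scale1r big1 ?addr0 // => j /negbTE ->.
by rewrite scale0r.
Qed.

(* The objective has no curvature along a critical direction, so boundedness
   forces a nonnegative slope at every feasible point; this is a statement of
   linear programming, whose dual multipliers can be taken extreme. *)
Lemma critical_multiplier I p x : qp_dom Q D p -> critical_cone Q D I x ->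
  exists mu, extreme_points [set mu | lev 0 mu /\ D^T *m mu = Q *m x.1] mu /\
    0 <= dotp p.1 x.1 + dotp p.2 mu.
Proof.
move=> /qp_domP [ne [gamma bnd]] [Qv Dv xi0 DJv _]; set v := x.1 in Qv Dv DJv *.
(* [Q v] is a combination of the rows of [D] in [I], all of which vanish on [v]. *)
have vQv : quadform Q v = 0.
  by rewrite quadform_dotp (subr0_eq Qv) dotp_mulmx trmxK Dv dotpC dotp0r.
have v0 : lev 0 (D *m v).
  apply/lev0P => i; have [iI|iI] := boolP (i \in I).
    move: Dv; rewrite rows_mulmx -(rows0 _ I) => /rows_eqP -> //.
    by rewrite mxE.
  move: DJv; rewrite rows_mulmx -(rows0 _ (~: I)%SET) => /rows_leP /(_ i).
  by rewrite mxE inE; apply.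
(* By symmetry of [Q] the slope at [z] along [v] is affine in [z], which makes this a linear
   inequality on the feasible set. *)
have slope z : lev p.2 (D *m z) -> - dotp p.1 v <= dotp (Q *m v) z.
  move=> hz; rewrite -subr_ge0 opprK.
  have -> : dotp (Q *m v) z + dotp p.1 v = dotp (p.1 + Q *m z) v.
    by rewrite dotpDl addrC [dotp _ z]dotpC dotp_mulmx Qsym.
  rewrite leNgt; apply/negP; set s := dotp _ _ => s0.
  pose t := (qp_obj Q p.1 z - gamma + 1) / - s.
  have t0 : 0 <= t.
    by rewrite divr_ge0 ?oppr_ge0 ?(ltW s0) // addr_ge0 ?subr_ge0 ?bnd.
  have /bnd : lev p.2 (D *m (z + t *: v)).
    move=> i; rewrite mulmxDr -scalemxAr mxE [X in _ + X]mxE.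
    by rewrite (le_trans (hz i)) // lerDl mulr_ge0 // (proj1 (lev0P _)).
  rewrite (qp_obj_line Qsym) vQv mulr0 addr0 -/s.
  by rewrite /t invrN mulrN mulNr mulrVK ?unitfE ?lt_eqF //; lra.
have [mu [mu0 Dmu hmu]] := affine_farkas ne slope.
have [mu' [ext le]] := @extreme_point_exists _ _ _ D p.2 _ mu ne (conj mu0 Dmu).
by exists mu'; split=> //; lra.
Qed.

Section Selections.
Variables (L : {set 'I_k} -> nat)
  (gen : forall I : {set 'I_k}, 'I_(L I) -> 'cV[R]_m * 'cV[R]_k).
Hypothesis gens : is_generators Q D gen.

Lemma qp_dom_selection p : qp_dom Q D p ->
  exists mu, mult_selections Q D gen mu /\ dom_mu D gen mu p.
Proof.
move=> hp.
have h I (l : 'I_(L I)) := critical_multiplier hp (critical_generator l gens).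
exists (fun I l => projT1 (cid (h I l))); split=> [I l|].
  by case: (cid (h I l)) => mu [].
split=> [|I l]; last by case: (cid (h I l)) => mu [].
have [[z hz] _] := proj1 (qp_domP _) hp.
exists z, (D *m z - p.2); split; last by rewrite opprB addrC subrK.
exact: (proj1 (lev_sub _ _)).
Qed.

Lemma dom_mu_QD_polyhedral mu I :
  polyhedral_cone [set x | (dom_mu D gen mu `&` QD Q D I) (usubmx x, dsubmx x)].
Proof.
pose T := {I : {set 'I_k} & 'I_(L I)}.
pose N : 'M[R]_(#|{: T}|, m + k) := \matrix_(i < #|{: T}|)
  let: existT J l := enum_val i in (col_mx (gen l).1 (mu J l))^T.
have [r [M hM]] := polyhedral_coneI (QD_polyhedral I) (polyhedral_cone_ge0 N).
exists r, M => x; rewrite -hM /=.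
have NE : lev 0 (N *m x) <-> forall J (l : 'I_(L J)),
    0 <= dotp (usubmx x) (gen l).1 + dotp (dsubmx x) (mu J l).
  have E J (l : 'I_(L J)) : dotp (usubmx x) (gen l).1 + dotp (dsubmx x) (mu J l) =
      dotp (col_mx (gen l).1 (mu J l)) x.
    by rewrite -{3}(vsubmxK x) dotp_col_mx !(dotpC _ (usubmx x)) !(dotpC _ (dsubmx x)).
  rewrite lev0P; split=> h => [J l|i].
    have := h (enum_rank (Tagged (fun J => 'I_(L J)) l)).
    by rewrite mulmx_dotp rowK enum_rankK /= trmxK E.
  by rewrite mulmx_dotp rowK; case: (enum_val i) => J l; rewrite trmxK -E.
split=> [[[_ hl] hQ]|[hQ /NE hl]]; first by split=> //; apply/NE.
split=> //; split=> //=.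
(* A feasible [z] exhibits the right-hand side as [D z] minus its slack. *)
have [z hz] := QD_feasible hQ.
exists z, (D *m z - dsubmx x); split; last by rewrite opprB addrC subrK.
exact: (proj1 (lev_sub _ _)).
Qed.

(** The cover must be indexed by a finite type, which the selections of multipliers are not as
    functions. They are replaced by their support patterns, which determine them by
    [extreme_point_support]. *)
Lemma dc_of_quadratic_family : convex_set (qp_dom Q D) ->
  (forall P, family_F Q D gen P -> quadratic_on P (qp_opt Q D)) ->
  dc_on (qp_dom Q D) (qp_opt Q D).
Proof.
move=> conv quad.
pose T := {I : {set 'I_k} & 'I_(L I)}.
pose with_support (s : {ffun T -> {set 'I_k}}) mu :=
  mult_selections Q D gen mu /\
  forall J (l : 'I_(L J)) i, (mu J l i 0 != 0) = (i \in s (existT _ J l)).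
(* Only the patterns that some selection realizes. *)
pose U := {s : {ffun T -> {set 'I_k}} | `[< exists mu, with_support s mu >]}.
have hU (u : U) : exists mu, with_support (val u) mu by exact/asboolP/(valP u).
pose mu_ (u : U) := projT1 (cid (hU u)).
have mu_P u : with_support (val u) (mu_ u) by rewrite /mu_; case: (cid _).
apply: (@dc_of_polyhedral_pieces _ _ _ (U * {set 'I_k})%type
  (fun ui => dom_mu D gen (mu_ ui.1) `&` QD Q D ui.2)) => //.
- by move=> [u I]; exact: dom_mu_QD_polyhedral.
- by move=> [u I]; apply: quad; exists (mu_ u), I; split=> //; case: (mu_P u).
move=> p hp; have [I hI] := qp_dom_QD hp; have [mu [sel dom]] := qp_dom_selection hp.
pose s := [ffun t : T => [set i | mu (tag t) (tagged t) i 0 != 0]%SET].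
have smu : with_support s mu by split=> // J l i; rewrite ffunE inE.
have hs : `[< exists mu, with_support s mu >] by apply/asboolP; exists mu.
pose u : U := exist _ s hs.
have E J l : mu_ u J l = mu J l.
  have [sel' supp'] := mu_P u.
  apply: (extreme_point_support (sel' J l) (sel J l)) => i.
  by rewrite supp' (proj2 smu).
exists (u, I); split=> //=; split; first by case: dom.
by move=> J l; rewrite E; case: dom.
Qed.

End Selections.

End ValueFunction.

(** * The positive semidefinite case *)

Section PositiveSemidefinite.
Variables (R : realType) (m k : nat) (Q : 'M[R]_m) (D : 'M[R]_(k, m)).
Hypotheses (Qsym : Q^T = Q) (Qpsd : psd Q).

Lemma qp_obj_tangent q z y :
  qp_obj Q q z + dotp (q + Q *m z) (y - z) <= qp_obj Q q y.
Proof.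
rewrite -[in leRHS](subrKC z y) -[y - z in leRHS]scale1r (qp_obj_line Qsym).
by rewrite mul1r lerDl mulr_ge0 // ?Qpsd // divr_ge0 // sqr_ge0.
Qed.

(** The tangent bound at [z] suffices: by stationarity the slope towards a feasible [y] is [eta]
    paired with the slack of [y] in the rows [I]. *)
Lemma qp_opt_psd_KKT I (p : 'cV[R]_m * 'cV[R]_k) z eta :
  p.1 + Q *m z - (rows I D)^T *m eta = 0 -> rows I D *m z = rows I p.2 ->
  lev 0 eta -> lev (rows (~: I)%SET p.2) (rows (~: I)%SET D *m z) ->
  qp_opt Q D p = (qp_obj Q p.1 z)%:E.
Proof.
move=> /subr0_eq stat act eta0 inact; apply: qp_opt_min => [i|y hy].
  have [iI|iI] := boolP (i \in I).
    by move: act; rewrite rows_mulmx => /rows_eqP ->.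
  by move: inact; rewrite rows_mulmx => /rows_leP; apply; rewrite inE.
apply: le_trans (qp_obj_tangent _ z _); rewrite lerDl stat -dotp_mulmx.
apply: dotp_ge0 => //; rewrite mulmxBr act rows_mulmx.
by apply: (proj1 (lev_sub _ _)); apply/rows_leP => i _; exact: hy.
Qed.

(** The KKT point [z] need not depend linearly on the data, but a generalized inverse gives a
    solution [H *m x] of the same equations that does. It may be infeasible, yet it has the same
    objective value: the difference [d] of the two lies in the kernel of [B], and [Q d] lies in the
    range of [B^T]. *)
Lemma qp_opt_psd_quadratic I : quadratic_on (QD Q D I) (qp_opt Q D).
Proof.
pose B := rows I D; pose K := block_mx Q (- B^T) B 0.
pose F : 'M[R]_(m + #|I|, m + k) := block_mx (- 1%:M) 0 0 (rows I 1%:M).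
(* A solution of the stationarity system depending linearly on [(q, b)]. *)
pose H := usubmx (pinvmx K *m F).
pose E : 'M[R]_(m, m + k) := row_mx 1%:M 0.
exists (E^T *m H + 2^-1 *: (H^T *m Q *m H)), 0, 0.
move=> [q b] /= [z [eta [stat act eta0 inact]]].
rewrite (qp_opt_psd_KKT stat act eta0 inact) /= dotpC dotp0r !addr0; congr (_%:E).
set x := col_mx q b.
have Fx : F *m x = col_mx (- q) (rows I b).
  by rewrite mul_block_col !mul0mx addr0 add0r mulNmx mul1mx rows_mulmx mul1mx.
have Kz : K *m col_mx z eta = F *m x.
  rewrite Fx mul_block_col mul0mx addr0 act mulNmx; congr col_mx.
  by move/subr0_eq: stat => <-; rewrite opprD addrCA subrr addr0.
have HE : usubmx (pinvmx K *m F *m x) = H *m x by rewrite mul_usub_mx.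
(* The generalized inverse solves the system because [(z, eta)] shows it to be solvable. *)
have : K *m (pinvmx K *m F *m x) = F *m x.
  by rewrite -mulmxA -Kz (mulmxA _ K) (mulmxA K) (mulmxA K) mulmxKpV.
rewrite Fx -(vsubmxK (pinvmx K *m F *m x)) HE; set w := dsubmx _.
rewrite mul_block_col mul0mx addr0 mulNmx => /eq_col_mx [Kw1 Kw2].
pose d := H *m x - z.
have Bd : B *m d = 0 by rewrite mulmxBr Kw2 act subrr.
have Qd : Q *m d = B^T *m (w - eta).
  rewrite mulmxBr -(subrK (B^T *m w) (Q *m (H *m x))) Kw1.
  rewrite -[Q *m z](addKr q) (subr0_eq stat) mulmxBr opprD opprK.
  by rewrite addrACA addNr add0r addrC.
have -> : qp_obj Q q z = qp_obj Q q (H *m x).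
  rewrite -[H *m x](subrKC z) -/d -[d]scale1r (qp_obj_line Qsym).
  rewrite (subr0_eq stat) -dotp_mulmx Bd dotp0r mulr0 addr0.
  by rewrite quadform_dotp Qd dotp_mulmx trmxK Bd dotpC dotp0r mulr0 addr0.
have qE : q = E *m x by rewrite mul_row_col mul1mx mul0mx addr0.
rewrite /qp_obj {1}qE !quadform_dotp mulmxDl -scalemxAl dotpDr dotpZr.
by rewrite -!mulmxA (dotp_mulmx E^T) (dotp_mulmx H^T) !trmxK.
Qed.

(** Primal and dual feasibility are jointly convex conditions on the data and the witnesses, from
    which convexity of the domain is read off. *)
Lemma qp_dom_psdP (p : 'cV[R]_m * 'cV[R]_k) : qp_dom Q D p <->
  (exists z, lev p.2 (D *m z)) /\
  (exists z mu, lev 0 mu /\ p.1 + Q *m z = D^T *m mu).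
Proof.
split=> [hp|[ne [z [mu [mu0 stat]]]]].
  have [I [z [eta [stat act eta0 inact]]]] := qp_dom_QD Qsym hp.
  split; first by have [] := proj1 (qp_domP _ _ _) hp.
  (* The multiplier [eta] extended by zero outside [I]. *)
  exists z, ((rows I 1%:M)^T *m eta); split.
    apply/lev0P => i; rewrite mxE; apply: sumr_ge0 => j _.
    by rewrite !mxE mulr_ge0 ?(proj1 (lev0P _)).
  by rewrite (subr0_eq stat) mulmxA -trmx_mul rows_mulmx mul1mx.
(* The lower bound is the tangent at [z], with weak duality bounding its linear part on the feasible
   set. *)
apply/qp_domP; split=> //; exists (qp_obj Q p.1 z + (dotp p.2 mu - dotp (D^T *m mu) z)).
move=> y hy; apply: le_trans (qp_obj_tangent _ z _); rewrite lerD2l stat.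
rewrite dotpDr dotpNr lerD2r -dotp_mulmx (dotpC p.2) -subr_ge0 -dotpNr -dotpDr.
by apply: dotp_ge0 => //; exact: (proj1 (lev_sub _ _)).
Qed.

Lemma qp_dom_psd_convex : convex_set (qp_dom Q D).
Proof.
move=> p p' t; rewrite !inE => /qp_dom_psdP [[y hy] [z [mu [mu0 stat]]]].
move=> /qp_dom_psdP [[y' hy'] [z' [mu' [mu0' stat']]]]; apply/qp_dom_psdP.
have t0 : 0 <= t%:num by [].
have t1 : 0 <= 1 - t%:num by rewrite subr_ge0 le1.
split.
  exists (t%:num *: y + (1 - t%:num) *: y') => i.
  rewrite mulmxDr -!scalemxAr /= mxE [X in X + _]mxE [X in _ + X]mxE.
  by rewrite mxE [in leRHS]mxE [X in _ <= _ + X]mxE lerD // ler_wpM2l.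
exists (t%:num *: z + (1 - t%:num) *: z'), (t%:num *: mu + (1 - t%:num) *: mu').
split.
  apply/lev0P => i; rewrite !mxE.
  by rewrite addr_ge0 // mulr_ge0 // (proj1 (lev0P _)).
by rewrite !mulmxDr -!scalemxAr -stat -stat' /= !scalerDr addrACA.
Qed.

Lemma qp_opt_psd_dc : dc_on (qp_dom Q D) (qp_opt Q D).
Proof.
apply: (@dc_of_polyhedral_pieces _ _ _ {set 'I_k} (QD Q D)).
- exact: qp_dom_psd_convex.
- exact: QD_polyhedral.
- exact: qp_opt_psd_quadratic.
- exact: qp_dom_QD.
Qed.

End PositiveSemidefinite.

Theorem theorem12 (R : realType) (m k : nat) (Q : 'M[R]_m) (D : 'M[R]_(k, m))
    (Qsym : Q^T = Q) :
  (copositive_on Q (D_inf D) ->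
   convex_set (qp_dom Q D) ->
   forall (L : {set 'I_k} -> nat)
          (gen : forall I : {set 'I_k}, 'I_(L I) -> 'cV[R]_m * 'cV[R]_k),
     is_generators Q D gen ->
     (forall P, family_F Q D gen P -> quadratic_on P (qp_opt Q D)) ->
     dc_on (qp_dom Q D) (qp_opt Q D))
  /\
  (psd Q -> dc_on (qp_dom Q D) (qp_opt Q D)).
Proof.
split=> [_ conv L gen gens quad|Qpsd]; last exact: qp_opt_psd_dc.
exact: dc_of_quadratic_family gens conv quad.
Qed.
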